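(* Let $Z$ be a normal projective toric variety with Cox ring $\mathcal R(Z)=\mathbb C[x_1,\dots,x_r]$, let $g_1,g_2\in\mathcal R(Z)$ be homogeneous elements which are general among linear combinations of their monomials, and let $Y\subseteq Z(E)$ be the hypersurface defined by $F=t_1g_1+t_2g_2$. Then $Y$ is quasismooth if and only if for any toric stratum $\hat D_I\subseteq B$ one of the following holds, where $J=I\cap\{1,\dots,r\}$: (i) $\hat D_I\subset\hat B_1$, $\hat D_I\not\subset\hat B_2$, and the collection of polytopes $\{\Delta_I(g_1^\rho t_1):\rho\in J\}\cup\{\Delta_I(g_2')\}$ is dependent; (ii) $\hat D_I\subset\hat B_2$, $\hat D_I\not\subset\hat B_1$, and the collection of polytopes $\{\Delta_I(g_2^\rho t_2):\rho\in J\}\cup\{\Delta_I(g_1')\}$ is dependent; (iii) $\hat D_I\subset\hat B_1\cap\hat B_2$ and the collection of polytopes $\{\Delta_I(g_1^\rho t_1+g_2^\rho t_2):\rho\in J\}$ is dependent.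
   Context: Everything is over $\mathbb C$. $\mathcal R(Z)$ is graded by $\mathrm{Cl}(Z)$, $\deg x_i=\alpha_i$, with irrelevant ideal $\mathcal I$; $\hat Z\subset\mathbb C^r$ is the complement of the zero set of $\mathcal I$. Let $d_i=\deg g_i$, $d=d_1+d_2$, and let $E_i$ be the divisor of $Z$ defined by $g_i$. $Z(E)=\mathbb P(\mathcal O_Z(E_1)\oplus\mathcal O_Z(E_2))$ is the toric variety with Cox ring in the variables $(y_1,\dots,y_{r+2})=(x_1,\dots,x_r,t_1,t_2)$, graded by $\mathrm{Cl}(Z)\oplus\mathbb Z$ with $\deg x_i=(\alpha_i,0)$, $\deg t_i=(d-d_i,1)$, and such that $\widehat{Z(E)}=\hat Z\times(\mathbb C^2\setminus\{0\})$ is the complement of the irrelevant locus; $\hat p:\widehat{Z(E)}\to Z(E)$ is the characteristic morphism and $\hat\pi:\widehat{Z(E)}\to\hat Z$ the projection. $F$ is homogeneous of degree $(d,1)$. $Y=\{F=0\}$ is quasismooth if $\hat p^{-1}(Y)=\{F=0\}\subset\widehat{Z(E)}$ is smooth, i.e. $F$ and its partial derivatives have no common zero in $\widehat{Z(E)}$. $B\subseteq\widehat{Z(E)}$ is the common zero set of all monomials of $F$; $B_i\subseteq\hat Z$ is the common zero set of all monomials of $g_i$; $\hat B_i=\hat\pi^{-1}(B_i)$. For $I\subseteq\{1,\dots,r+2\}$, $\hat D_I=\{y_\rho=0:\rho\in I\}\subseteq\widehat{Z(E)}$, called a toric stratum when non-empty. For a polynomial $h$ in the $y$ variables, $\Delta_I(h)$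 is the Newton polytope of the restriction of $h$ to $\hat D_I$ (empty if this restriction is zero). If $\hat D_I\subset\hat B_i$, write $g_i=\sum_{\rho\in J}x_\rho g_i^\rho$ (the restriction of $g_i^\rho$ to $\hat D_I$ is determined by $g_i$: it is the sum of the terms $c\,\mu$ such that $c\,x_\rho\mu$ is a term of $g_i$ and $\mu$ involves no $x_\tau$ with $\tau\in J$). If $\hat D_I\not\subset\hat B_i$, write $g_i=g_i'+\sum_{\rho\in J}x_\rho g_i^\rho$ with $g_i'$ a polynomial in the variables $x_\tau$, $\tau\notin J$. A collection (indexed family) of polytopes in $\mathbb Q^k$ is dependent if it contains a subcollection of $l>0$ non-empty polytopes which can all be translated into an $(l-1)$-dimensional linear subspace. *)

(* Defs.v *)
From HB Require Import structures.
From mathcomp Require Import all_boot all_order all_algebra.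
From mathcomp Require Import complex mpoly.
From mathcomp Require Import reals ring.

Set Implicit Arguments.
Unset Strict Implicit.
Unset Printing Implicit Defensive.

Import GRing.Theory Num.Theory.
Local Open Scope ring_scope.

(** * Projective toric varieties, given by their fans *)

Definition pairing n (m v : 'rV[int]_n) : int := \sum_(k < n) m 0 k * v 0 k.

Definition primitive n (v : 'rV[int]_n) : Prop :=
  forall (k : int) (w : 'rV[int]_n), v = k *: w -> `|k| = 1.

Section Fans.
Variables (n r : nat) (u : 'I_r -> 'rV[int]_n).

(* Cones are encoded by the sets of indices of their rays. *)
Definition cone (s : {set 'I_r}) (v : 'rV[rat]_n) : Prop :=
  exists2 a : 'I_r -> rat, (forall i, 0 <= a i) &
    v = \sum_(i in s) a i *: map_mx intr (u i).

Definition is_face (t s : {set 'I_r}) : Prop :=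
  exists2 m : 'rV[int]_n, (forall i, i \in s -> 0 <= pairing m (u i)) &
    t = [set i in s | pairing m (u i) == 0].

(* The last two clauses, together with the presence of all the cones spanned
   by one [u i], force the [u i] with [i \in s] to be exactly the primitive
   generators of the rays of [cone s], without repetition. *)
Record is_fan (Sigma : {set {set 'I_r}}) : Prop := IsFan {
  fan_primitive : forall i, primitive (u i);
  fan_ray : forall i, [set i] \in Sigma;
  fan_pointed : forall s, s \in Sigma ->
    forall v, cone s v -> cone s (- v) -> v = 0;
  fan_face : forall s t, s \in Sigma -> is_face t s -> t \in Sigma;
  fan_inter_face : forall s t, s \in Sigma -> t \in Sigma ->
    is_face (s :&: t) s;
  fan_inter_cone : forall s t, s \in Sigma -> t \in Sigma ->
    forall v, cone s v -> cone t v -> cone (s :&: t) v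
}.

Definition complete_fan (Sigma : {set {set 'I_r}}) : Prop :=
  forall v, exists2 s, s \in Sigma & cone s v.

(* The divisor \sum_i a_i D_i is Cartier and ample on the complete toric
   variety of Sigma: it has a strictly convex support function, with local
   data the lattice points [m] attached to the maximal cones. *)
Definition ample (Sigma : {set {set 'I_r}}) (a : 'I_r -> int) : Prop :=
  forall s, maxset (mem Sigma) s ->
    exists m : 'rV[int]_n, forall i,
      if i \in s then pairing m (u i) = - a i else - a i < pairing m (u i).

End Fans.

Record projective_toric (r : nat) := ProjectiveToric {
  tdim : nat;
  ray : 'I_r -> 'rV[int]_tdim;
  fan : {set {set 'I_r}};
  fanP : is_fan ray fan;
  fan_complete : complete_fan ray fan;
  fan_projective : exists a, ample ray fan a
}.

(** * Class group, Cox ring of Z, Cox ring of Z(E) *)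

(* Cl(Z) is the quotient of the group Z^r of torus-invariant divisors by linear
   equivalence, i.e. by the divisors \sum_i <m, u_i> D_i of the characters;
   alpha_i is the class of D_i, so that x^m has degree the class of
   \sum_i m_i D_i. *)
Definition lin_equiv r (Z : projective_toric r) (D D' : 'rV[int]_r) : Prop :=
  exists m, forall i, D 0 i - D' 0 i = pairing m (ray Z i).

Definition divm r (m : 'X_{1..r}) : 'rV[int]_r := \row_i (m i)%:Z.

Definition homogeneous (C : fieldType) r (Z : projective_toric r)
  (d : 'rV[int]_r) (g : {mpoly C[r]}) : Prop :=
  forall m, m \in msupp g -> lin_equiv Z (divm m) d.

Section Indices.
Variable r : nat.
Definition ix (i : 'I_r) : 'I_(r + 2) := lshift 2 i.
Definition it1 : 'I_(r + 2) := rshift r ord0.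
Definition it2 : 'I_(r + 2) := rshift r ord_max.
End Indices.
Arguments it1 {r}.
Arguments it2 {r}.

(* The element of Z^r + Z representing the degree of y^m in the Cox ring
   of Z(E), where d1, d2 represent the degrees of g1, g2. *)
Definition divmE r (d1 d2 : 'rV[int]_r) (m : 'X_{1..r + 2}) :
    'rV[int]_r * int :=
  let d := d1 + d2 in
  ((\row_i (m (ix i))%:Z) + (d - d1) *+ m it1 + (d - d2) *+ m it2,
   (m it1)%:Z + (m it2)%:Z).

Definition homogeneousE (C : fieldType) r (Z : projective_toric r)
  (d1 d2 : 'rV[int]_r) (e : 'rV[int]_r * int) (h : {mpoly C[r + 2]}) : Prop :=
  forall m, m \in msupp h ->
    lin_equiv Z (divmE d1 d2 m).1 e.1 /\ (divmE d1 d2 m).2 = e.2.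

Section Hypersurface.
Variables (C : fieldType) (r : nat) (Z : projective_toric r).
Implicit Types (g : {mpoly C[r]}) (h : {mpoly C[r + 2]}).
Implicit Types (z : 'I_r -> C) (y : 'I_(r + 2) -> C) (I : {set 'I_(r + 2)}).

(* The irrelevant ideal is generated by the monomials \prod_(i \notin s) x_i,
   for s ranging over the cones. *)
Definition hatZ z : Prop :=
  exists2 s, s \in fan Z & \prod_(i | i \notin s) z i != 0.

Definition hatpi y : 'I_r -> C := fun i => y (ix i).

Definition hatZE y : Prop := hatZ (hatpi y) /\ ~ (y it1 = 0 /\ y it2 = 0).

(* The inclusion C[x] -> C[x, t1, t2]. *)
Definition toE g : {mpoly C[r + 2]} := g \mPo [tuple 'X_(ix i) | i < r].

Definition polyF g1 g2 : {mpoly C[r + 2]} :=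
  'X_it1 * toE g1 + 'X_it2 * toE g2.

Definition quasismooth h : Prop :=
  ~ exists y, [/\ hatZE y, h.@[y] = 0 & forall i, (h^`M(i)).@[y] = 0].

Definition baseB h y : Prop :=
  hatZE y /\ forall m, m \in msupp h -> ('X_[m] : {mpoly C[r + 2]}).@[y] = 0.

Definition baseBi g z : Prop :=
  hatZ z /\ forall m, m \in msupp g -> ('X_[m] : {mpoly C[r]}).@[z] = 0.

Definition hatB g y : Prop := hatZE y /\ baseBi g (hatpi y).

Definition hatD I y : Prop := hatZE y /\ forall i, i \in I -> y i = 0.

Definition toric_stratum I : Prop := exists y, hatD I y.

Definition Jset I : {set 'I_r} := [set i | ix i \in I].

End Hypersurface.

Section Homogeneity.
Variable C : fieldType.

Lemma msupp_toE r (g : {mpoly C[r]}) m : m \in msupp (toE g) ->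
  exists2 m', m' \in msupp g &
    [/\ m it1 = 0, m it2 = 0 & forall i, m (ix i) = m' i]%N.
Proof.
rewrite /toE comp_mpolyEX => /msupp_sum_le.
rewrite filter_predT => /flatten_mapP[m' m's /msuppZ_le].
rewrite comp_mpolyX.
under eq_bigr => i _ do rewrite tnth_mktuple mpolyXn.
rewrite mprodXE msuppX inE => /eqP ->; exists m' => //.
split.
- rewrite mnm_sumE big1 // => i _; rewrite mulmnE mnm1E.
  by rewrite /ix eq_lrshift mul0n.
- rewrite mnm_sumE big1 // => i _; rewrite mulmnE mnm1E.
  by rewrite /ix eq_lrshift mul0n.
move=> i; rewrite mnm_sumE (bigD1 i) //= mulmnE mnm1E eqxx mul1n big1 ?addn0 //.
by move=> j ne; rewrite mulmnE mnm1E /ix (inj_eq (@lshift_inj _ _)) (negPf ne) mul0n.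
Qed.

Lemma homogeneous_polyF r (Z : projective_toric r) d1 d2 (g1 g2 : {mpoly C[r]}) :
    homogeneous Z d1 g1 -> homogeneous Z d2 g2 ->
  homogeneousE Z d1 d2 (d1 + d2, 1) (polyF g1 g2).
Proof.
have ne : (it1 == it2 :> 'I_(r + 2)) = false.
  by rewrite /it1 /it2 !eq_shift.
move=> h1 h2 m /msuppD_le; rewrite mem_cat => /orP[] /msuppM_le /allpairsP[[a b]].
  rewrite msuppX inE /= => -[/eqP-> /msupp_toE[m' /h1 [p pE] [e1 e2 eb]] ->].
  rewrite /divmE !mnmDE !mnm1E eqxx ne e1 e2; split=> //.
  exists p => i; rewrite -pE ?addn0 /fst /= ?mulr1n ?mulr0n !mxE.
  rewrite mnmDE mnm1E eb /it1 /ix eq_rlshift add0n; ring.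
rewrite msuppX inE /= => -[/eqP-> /msupp_toE[m' /h2 [p pE] [e1 e2 eb]] ->].
rewrite /divmE !mnmDE !mnm1E eqxx eq_sym ne e1 e2; split=> //.
exists p => i; rewrite -pE ?addn0 /fst /= ?mulr1n ?mulr0n !mxE.
rewrite mnmDE mnm1E eb /it2 /ix eq_rlshift add0n; ring.
Qed.
End Homogeneity.

(** * Newton polytopes and dependency *)

(* The restriction of h to the coordinate subspace { x_i = 0 : i \in I }. *)
Definition restr (C : fieldType) k (I : {set 'I_k}) (h : {mpoly C[k]}) :
    {mpoly C[k]} :=
  \sum_(m <- msupp h | [forall i in I, m i == 0%N]) h@_m *: 'X_[m].

(* The restriction of g^rho to { x_J = 0 }, for any decomposition
   g = \sum_(rho in J) x_rho g^rho (see [gpart_unique]). *)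
Definition gpart (C : fieldType) r (J : {set 'I_r}) (rho : 'I_r)
    (g : {mpoly C[r]}) : {mpoly C[r]} :=
  \sum_(m <- msupp g | (U_(rho) <= m)%MM &&
          [forall tau in J, (m - U_(rho))%MM tau == 0%N])
     g@_m *: 'X_[m - U_(rho)].

(* The part g' not involving the x_J in g = g' + \sum_(rho in J) x_rho g^rho. *)
Definition gprime (C : fieldType) r (J : {set 'I_r}) (g : {mpoly C[r]}) :
    {mpoly C[r]} := restr J g.

Section Restriction.
Variable C : fieldType.

Lemma mcoeff_restr k (I : {set 'I_k}) (h : {mpoly C[k]}) m :
  (restr I h)@_m = if [forall i in I, m i == 0%N] then h@_m else 0.
Proof.
rewrite /restr raddf_sum /= -big_filter.
under eq_bigr => m' _ do rewrite mcoeffZ mcoeffX.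
have [mI|mI] := boolP (m \in [seq m' : 'X_{1..k} <- msupp h | [forall i in I, m' i == 0%N]]).
  rewrite (bigD1_seq m) ?filter_uniq ?msupp_uniq //= eqxx mulr1 big1 ?addr0.
    by move: mI; rewrite mem_filter => /andP[-> _].
  by move=> m' /negPf->; rewrite mulr0.
rewrite big_seq big1 => [|m' m'I].
  move: mI; rewrite mem_filter; case: ifP => //= _.
  by move=> /memN_msupp_eq0->.
by case: eqP m'I => [->|]; rewrite ?(negPf mI) ?mulr0.
Qed.

Lemma mcoeff_gpart r (J : {set 'I_r}) rho (g : {mpoly C[r]}) m :
  (gpart J rho g)@_m =
    if [forall tau in J, m tau == 0%N] then g@_(m + U_(rho)) else 0.
Proof.
rewrite /gpart raddf_sum /= -big_filter.
under eq_bigr => m' _ do rewrite mcoeffZ mcoeffX.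
set s := filter _ _; have us : uniq s by rewrite filter_uniq ?msupp_uniq.
have sE m' : m' \in s -> (m' - U_(rho) == m)%MM = (m' == m + U_(rho))%MM.
  rewrite mem_filter => /andP[/andP[le _] _]; apply/eqP/eqP => [<-|->].
    by rewrite submK.
  by rewrite addmK.
have [mI|mI] := boolP ((m + U_(rho))%MM \in s).
  rewrite (bigD1_seq _ mI) //= addmK eqxx mulr1 big_seq_cond big1 ?addr0.
    by move: mI; rewrite mem_filter addmK => /andP[/andP[_ ->] _].
  by move=> m' /andP[/sE-> /negPf->]; rewrite mulr0.
rewrite big_seq big1 => [|m' m's].
  move: mI; rewrite mem_filter addmK; case: ifP; rewrite ?andbF // andbT lem_addl /=.
  by move=> _ /memN_msupp_eq0->.
by rewrite sE //; case: eqP m's => [->|]; rewrite ?(negPf mI) ?mulr0.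
Qed.

Lemma gpart_unique r (J : {set 'I_r}) (g g' : {mpoly C[r]})
    (h : 'I_r -> {mpoly C[r]}) :
    restr J g' = g' -> g = g' + \sum_(rho in J) 'X_rho * h rho ->
  g' = gprime J g /\ forall rho, rho \in J -> gpart J rho g = restr J (h rho).
Proof.
move=> g'J gE.
have coefX rho p m : ('X_rho * p : {mpoly C[r]})@_m =
    if m rho == 0%N then 0 else p@_(m - U_(rho)).
  have [m0|m0] := eqVneq (m rho) 0%N.
    apply: memN_msupp_eq0; apply/negP => /msuppM_le /allpairsP[[m1 m2]].
    rewrite msuppX inE /= => -[/eqP-> _ mE].
    by move: m0; rewrite mE mnmDE mnm1E eqxx.
  have le : (U_(rho) <= m)%MM by rewrite lep1mP.
  rewrite -commr_mpolyX -[in LHS](submK le) [X in (_ * _)@_X]addmC; exact: mcoeffMX.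
split.
  apply/mpolyP => m; rewrite mcoeff_restr gE mcoeffD raddf_sum /=.
  rewrite -[in LHS]g'J mcoeff_restr; case: ifP => // /'forall_implyP mJ.
  by rewrite big1 ?addr0 // => rho rJ; rewrite coefX mJ.
move=> rho rJ; apply/mpolyP => m; rewrite mcoeff_restr mcoeff_gpart.
case: ifP => // /'forall_implyP mJ.
rewrite gE mcoeffD raddf_sum /= (bigD1 rho) //= coefX.
rewrite mnmDE mnm1E eqxx addn1 /= addmK.
rewrite -g'J mcoeff_restr ifF; last first.
  apply/negP => /'forall_implyP /(_ _ rJ).
  by rewrite mnmDE mnm1E eqxx addn1.
rewrite add0r big1 ?addr0 // => tau /andP[tJ /negPf ne].
by rewrite coefX mnmDE mnm1E (eq_sym rho) ne addn0 mJ.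
Qed.

End Restriction.

Definition newton (C : fieldType) k (h : {mpoly C[k]}) (p : 'rV[rat]_k) :
    Prop :=
  exists w : 'X_{1..k} -> rat,
    [/\ forall m, 0 <= w m,
        \sum_(m <- msupp h) w m = 1 &
        p = \sum_(m <- msupp h) w m *: (\row_i (m i)%:R)].

(* The family (P j), indexed by j \in S, of subsets of Q^k is dependent. *)
Definition dependent k (K : finType) (S : {set K})
    (P : K -> 'rV[rat]_k -> Prop) : Prop :=
  exists T : {set K},
    [/\ T \subset S, (0 < #|T|)%N,
        forall j, j \in T -> exists p, P j p &
        exists V : {vspace 'rV[rat]_k}, \dim V = #|T|.-1 /\
          forall j, j \in T -> exists v, forall p, P j p -> p + v \in V].

Section Conditions.
Variables (C : fieldType) (r : nat) (Z : projective_toric r).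
Implicit Types (g : {mpoly C[r]}) (I : {set 'I_(r + 2)}).

Definition Delta I (h : {mpoly C[r + 2]}) : 'rV[rat]_(r + 2) -> Prop :=
  newton (restr I h).

Definition included_only (g g' : {mpoly C[r]}) I : Prop :=
  (forall y, hatD Z I y -> hatB Z g y) /\
  ~ (forall y, hatD Z I y -> hatB Z g' y).

Definition cond_i g1 g2 I : Prop :=
  included_only g1 g2 I /\
  dependent (None |: [set Some rho | rho in Jset I])
    (fun j => if j is Some rho then Delta I (toE (gpart (Jset I) rho g1) * 'X_it1)
              else Delta I (toE (gprime (Jset I) g2))).

Definition cond_ii g1 g2 I : Prop :=
  included_only g2 g1 I /\
  dependent (None |: [set Some rho | rho in Jset I])
    (fun j => if j is Some rho then Delta I (toE (gpart (Jset I) rho g2) * 'X_it2)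
              else Delta I (toE (gprime (Jset I) g1))).

Definition cond_iii g1 g2 I : Prop :=
  (forall y, hatD Z I y -> hatB Z g1 y /\ hatB Z g2 y) /\
  dependent (Jset I)
    (fun rho => Delta I (toE (gpart (Jset I) rho g1) * 'X_it1 +
                         toE (gpart (Jset I) rho g2) * 'X_it2)).

End Conditions.

(** * General linear combinations of given monomials *)

Definition lincomb (C : fieldType) r (A : seq 'X_{1..r})
    (c : 'I_(size A) -> C) : {mpoly C[r]} :=
  \sum_(j < size A) c j *: 'X_[tnth (in_tuple A) j].

(* P holds for all pairs of linear combinations of A1 and of A2 whose
   coefficients lie in some non-empty Zariski open set, which may be taken to
   be the complement of a hypersurface { H = 0 }. *)
Definition for_general (C : fieldType) r (A1 A2 : seq 'X_{1..r})
    (P : {mpoly C[r]} -> {mpoly C[r]} -> Prop) : Prop :=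
  exists2 H : {mpoly C[size A1 + size A2]}, H != 0 &
    forall c : 'I_(size A1 + size A2) -> C, H.@[c] != 0 ->
      P (lincomb (fun j => c (lshift (size A2) j)))
        (lincomb (fun j => c (rshift (size A1) j))).

(* Main.v *)
Require Import Defs.
From mathcomp Require Import all_boot all_order all_algebra all_field.
From mathcomp Require Import complex mpoly.
From mathcomp Require boolp.
From mathcomp Require Import reals.
From mathcomp Require Import ring zify.

(** Why the criterion holds.

    Write the polynomial F = t1 g1 + t2 g2 as a sum of c_j y^(a_j) over the
    pairs formed by t1 and a monomial of g1, or t2 and a monomial of g2.  Its
    coefficients are those of g1 and g2, hence general.  Every point of the
    domain of the characteristic morphism lies on exactly one orbit: the points
    whose vanishing coordinates are those of a set I.  Such a point is
    [annul I y] with y in the torus, and the orbit is contained in the domain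
    as soon as the stratum of I is non-empty.  So F is quasismooth if and only
    if no orbit of a stratum contains a singular zero of F, and the strata can
    be treated one at a time.

    If some monomial of F avoids the variables in I, so that the stratum is not
    in the base locus, then F restricts to a non-zero general polynomial, which
    has no singular zero in the torus ([generically_smooth_torus], a form of
    the theorem of Bertini).  Otherwise F and its derivatives along the stratum
    vanish identically, and the derivative in the direction of l in I restricts
    to the sum of c_j y^(a_j) / y_l over the block of the j such that a_j is of
    degree one in y_l and of degree zero in the other variables of I
    ([singular_annul]).  Different blocks are disjoint, so this is a system of
    equations with given supports and independent general coefficients.  By the
    theorem of Bernstein, Kushnirenko and Khovanskii such a system has a
    solution in the torus if and only if its supports are independent; this
    gives [hypersurface_criterion].

    One half of that theorem, as well as the statement of Bertini type, is a
    count of parameters.  The bad coefficients c are such that some of them, as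
    many as the elements of a set K, are given by the others and by monomials in
    y with exponents in a space of dimension less than #|K|.  Hence all of them
    are rational functions of fewer than N parameters, and such functions are
    algebraically dependent ([algebraic_dependence], [torus_elimination]).

    For the other half, elimination of quantifiers shows that a system with
    general coefficients is either always or never solvable
    ([formula_dichotomy]); so it is enough to find a solvable system outside any
    given hypersurface H = 0 of the space of coefficients.  By the theorem of
    Rado ([rado]) one can choose two monomials in each equation such that the
    vectors of differences are linearly independent.  Binomial systems with
    these exponents are always solvable ([binomial_system]).  Multiplying the
    chosen coefficients by a parameter s, and correcting them by terms that do
    not involve s in order to keep the solution, the value of H becomes a
    polynomial in s with leading coefficient the value at the binomial system
    of a leading form of H ([independent_solvable]).

    It remains to compare: the three cases of the statement are the possible
    positions of a stratum with respect to the base loci of g1 and g2, and in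
    each of them the polytopes listed are those of the blocks
    ([restr_gpart_ix], [gpart_it1], [gpart_it2], [conditionsE]). *)

Set Implicit Arguments.
Unset Strict Implicit.
Unset Printing Implicit Defensive.
Import Order.TTheory GRing.Theory Num.Theory.
Local Open Scope ring_scope.

(** * Properties of general points, and elimination of quantifiers *)

Definition generically (C : fieldType) N (P : ('I_N -> C) -> Prop) : Prop :=
  exists2 H : {mpoly C[N]}, H != 0 & forall c, H.@[c] != 0 -> P c.

Lemma generically_and (C : fieldType) N (P Q : ('I_N -> C) -> Prop) :
  generically P -> generically Q -> generically (fun c => P c /\ Q c).
Proof.
move=> [H1 H1n0 H1P] [H2 H2n0 H2P]; exists (H1 * H2); first by rewrite mulf_neq0.
by move=> c; rewrite mevalM mulf_eq0 negb_or => /andP[/H1P ? /H2P].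
Qed.

Lemma generically_imp (C : fieldType) N (P Q : ('I_N -> C) -> Prop) :
  (forall c, P c -> Q c) -> generically P -> generically Q.
Proof. by move=> PQ [H Hn0 HP]; exists H => // c /HP/PQ. Qed.

Lemma generically_all (C : fieldType) N (T : finType)
    (P : T -> ('I_N -> C) -> Prop) :
  (forall t, generically (P t)) -> generically (fun c => forall t, P t c).
Proof.
move=> gP; suff: generically (fun c => forall t, t \in enum T -> P t c).
  by apply: generically_imp => c Pc t; apply: Pc; rewrite mem_enum.
elim: (enum T) => [|t s IH]; first by exists 1; rewrite ?oner_neq0.
apply: generically_imp (generically_and (gP t) IH) => c [Ptc Psc] u.
by rewrite in_cons => /predU1P[->|/Psc].
Qed.

Definition env (C : fieldType) N (c : 'I_N -> C) : seq C :=
  [seq c i | i <- enum 'I_N].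

Lemma nth_env (C : fieldType) N (c : 'I_N -> C) (i : 'I_N) : (env c)`_i = c i.
Proof. by rewrite (nth_map i) ?size_enum_ord // nth_ord_enum. Qed.

(** Terms without inverses are polynomials in the variables; a variable beyond
    the end of the environment evaluates to zero. *)
Lemma eval_rterm (C : fieldType) N (t : GRing.term C) : GRing.rterm t ->
  exists P : {mpoly C[N]}, forall c, GRing.eval (env c) t = P.@[c].
Proof.
elim: t => //=.
- move=> i _; have [iN|Ni] := ltnP i N.
    by exists 'X_(Ordinal iN) => c; rewrite mevalXU -nth_env.
  by exists 0 => c; rewrite meval0 nth_default // size_map size_enum_ord.
- by move=> x _; exists x%:MP => c; rewrite mevalC.
- by move=> n _; exists n%:R => c; rewrite rmorph_nat.
- by move=> t IHt u IHu /andP[/IHt[P PE] /IHu[Q QE]]; exists (P + Q) => c;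
  rewrite mevalD PE QE.
- by move=> t IHt /IHt[P PE]; exists (- P) => c; rewrite mevalN PE.
- by move=> t IHt n /IHt[P PE]; exists (P *+ n) => c; rewrite mevalMn PE.
- by move=> t IHt u IHu /andP[/IHt[P PE] /IHu[Q QE]]; exists (P * Q) => c;
  rewrite mevalM PE QE.
- by move=> t IHt n /IHt[P PE]; exists (P ^+ n) => c; rewrite rmorphXn /= PE.
Qed.

(** An equation P = Q holds identically or fails where P - Q does not vanish;
    Boolean combinations preserve the alternative. *)
Lemma qf_dichotomy (C : fieldType) N (f : GRing.formula C) :
    GRing.qf_form f && GRing.rformula f ->
  exists b, generically (fun c : 'I_N -> C => GRing.qf_eval (env c) f = b).
Proof.
elim: f => //=.
- by move=> b _; exists b, 1; rewrite ?oner_neq0.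
- move=> t u /andP[/(eval_rterm N)[P PE] /(eval_rterm N)[Q QE]].
  have [PQ|PQ] := eqVneq P Q.
    by exists true, 1; rewrite ?oner_neq0 // => c _; rewrite PE QE PQ eqxx.
  exists false, (P - Q); rewrite ?subr_eq0 // => c.
  by rewrite mevalB subr_eq0 PE QE => /negPf.
- move=> f IHf g IHg; rewrite andbACA => /andP[/IHf[b gb] /IHg[b' gb']].
  exists (b && b'); apply: generically_imp (generically_and gb gb').
  by move=> c [-> ->].
- move=> f IHf g IHg; rewrite andbACA => /andP[/IHf[b gb] /IHg[b' gb']].
  exists (b || b'); apply: generically_imp (generically_and gb gb').
  by move=> c [-> ->].
- move=> f IHf g IHg; rewrite andbACA => /andP[/IHf[b gb] /IHg[b' gb']].
  exists (b ==> b'); apply: generically_imp (generically_and gb gb').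
  by move=> c [-> ->].
- move=> f IHf /IHf[b gb]; exists (~~ b); apply: generically_imp gb.
  by move=> c ->.
Qed.

(** A definable set over an algebraically closed field is constructible, so it
    contains a dense open subset or is disjoint from one. *)
Lemma formula_dichotomy (C : closedFieldType) N (f : GRing.formula C) :
    generically (fun c : 'I_N -> C => GRing.holds (env c) f) \/
  generically (fun c : 'I_N -> C => ~ GRing.holds (env c) f).
Proof.
pose Cc := @solve_monicpoly C.
have okP := ClosedFieldQE.holds_ex_elim Cc.
have wfP := @ClosedFieldQE.wf_ex_elim C.
have fr := GRing.to_rform_rformula f.
have [b gb] := qf_dichotomy N (GRing.quantifier_elim_wf wfP fr).
have fP c := GRing.quantifier_elim_rformP wfP okP (env c) fr.
case: b gb => gb; [left|right]; apply: generically_imp gb => c.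
  by move/fP/GRing.to_rformP.
by move=> /negP qf /GRing.to_rformP/fP.
Qed.

(** The free variables are numbered from 0 to N - 1, and the k bound ones come
    next. *)
Definition exists_vars (C : fieldType) N k (f : GRing.formula C) :=
  foldr (fun i g => GRing.Exists i g) f (iota N k).

Lemma holds_exists_vars (C : fieldType) N k (f : GRing.formula C)
    (c : 'I_N -> C) :
  GRing.holds (env c) (exists_vars N k f) <->
  exists y : 'I_k -> C, GRing.holds (env c ++ env y) f.
Proof.
rewrite /exists_vars.
suff gen s : size s = N ->
    GRing.holds s (foldr (fun i g => GRing.Exists i g) f (iota N k)) <->
    exists2 t, size t = k & GRing.holds (s ++ t) f.
  have [|h1 h2] := gen (env c); first by rewrite size_map size_enum_ord.
  split=> [/h1[t sz h]|[y h]]; last first.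
    by apply: h2; exists (env y); rewrite // size_map size_enum_ord.
  exists (fun i : 'I_k => t`_i); suff -> : env (fun i : 'I_k => t`_i) = t by [].
  apply: (@eq_from_nth _ 0) => [|i]; rewrite size_map size_enum_ord ?sz // => ik.
  by exact: (nth_env _ (Ordinal ik)).
elim: k N s {c} => [|k IH] N s sz /=.
  split=> [h|[t /eqP]]; first by exists [::]; rewrite ?cats0.
  by rewrite size_eq0 => /eqP->; rewrite cats0.
have sE x : set_nth 0 s N x = rcons s x.
  apply: (@eq_from_nth _ 0) => [|i _].
    by rewrite size_set_nth size_rcons sz; apply/maxn_idPl.
  rewrite nth_set_nth /= nth_rcons sz; case: ltngtP => // lt.
  by rewrite nth_default // sz ltnW.
split.
  move=> [x]; rewrite sE => /IH[|t szt]; first by rewrite size_rcons sz.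
  by rewrite cat_rcons => h; exists (x :: t) => //=; rewrite szt.
move=> [[//|x t] [szt] h]; exists x; rewrite sE; apply/IH; first by rewrite size_rcons sz.
by exists t; rewrite ?cat_rcons.
Qed.

(** * Monomials on the torus *)

Definition tmon (C : fieldType) k (y : 'I_k -> C) (v : 'rV[int]_k) : C :=
  \prod_i y i ^ v 0 i.

Definition torus (C : fieldType) k (y : 'I_k -> C) : Prop := forall i, y i != 0.

Section TorusMonomials.
Variable C : fieldType.

Lemma tmon_neq0 k (y : 'I_k -> C) v : torus y -> tmon y v != 0.
Proof. by move=> y0; apply/prodf_neq0 => i _; rewrite expfz_neq0. Qed.

Lemma tmonD k (y : 'I_k -> C) v w : torus y ->
  tmon y (v + w) = tmon y v * tmon y w.
Proof.
move=> y0; rewrite /tmon -big_split /=; apply: eq_bigr => i _.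
by rewrite mxE expfzDr.
Qed.

Lemma tmon0 k (y : 'I_k -> C) : tmon y 0 = 1.
Proof. by rewrite /tmon big1 // => i _; rewrite mxE. Qed.

Lemma tmonZ k (y : 'I_k -> C) a v : tmon y (a *: v) = tmon (fun i => y i ^ a) v.
Proof. by apply: eq_bigr => i _; rewrite mxE -exprz_exp. Qed.

Lemma tmonZr k (y : 'I_k -> C) a v : tmon y (a *: v) = tmon y v ^ a.
Proof.
rewrite /tmon; elim/big_rec2: _ => [|i u w _ ->]; first by rewrite exp1rz.
by rewrite mxE expfzMl [a * _]mulrC exprz_exp.
Qed.

Lemma tmon_sum k (y : 'I_k -> C) (T : finType) (v : T -> 'rV[int]_k) : torus y ->
  tmon y (\sum_t v t) = \prod_t tmon y (v t).
Proof.
move=> y0; elim/big_rec2: _ => [|t u w _ <-]; first exact: tmon0.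
by rewrite tmonD.
Qed.

(** An integer matrix is a homomorphism of tori, which acts on exponents by
    multiplication. *)
Lemma tmon_comp k d (y : 'I_k -> C) (B : 'M[int]_(d, k)) v : torus y ->
  tmon (fun i => tmon y (row i B)) v = tmon y (v *m B).
Proof.
move=> y0; rewrite mulmx_sum_row tmon_sum //.
by apply: eq_bigr => i _; rewrite tmonZr.
Qed.

Lemma meval_tmon k (y : 'I_k -> C) (m : 'X_{1..k}) :
  ('X_[m] : {mpoly C[k]}).@[y] = tmon y (divm m).
Proof. by rewrite mevalX; apply: eq_bigr => i _; rewrite mxE. Qed.

End TorusMonomials.

Lemma nat_root (C : closedFieldType) q (y : C) : (0 < q)%N ->
  exists x, x ^ q%:Z = y.
Proof.
move=> q0; have [x xE] := @solve_monicpoly C q (fun i => if i == 0%N then y else 0) q0.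
exists x; rewrite -[RHS]mulr1 -exprnP xE; case: q q0 {xE} => // q _.
by rewrite big_ord_recl /= big1 ?addr0 // => i _; rewrite mul0r.
Qed.

Lemma torus_root (C : closedFieldType) k q (y : 'I_k -> C) : (0 < q)%N -> torus y ->
  exists2 x, torus x & forall i, x i ^ q%:Z = y i.
Proof.
move=> q0 y0; have /fin_all_exists[x xE] i := nat_root (y i) q0.
exists x => // i; apply: contraNneq (y0 i) => x0.
by rewrite -(xE i) x0 exp0rz eqz_nat (gtn_eqF q0).
Qed.

Lemma clear_denominators (T : finType) (f : T -> rat) :
  exists2 q : nat, (0 < q)%N & exists g : T -> int, forall t, (g t)%:~R = q%:R * f t.
Proof.
exists (\prod_t `|denq (f t)|)%N.
  by rewrite prodn_gt0 // => t; rewrite absz_gt0 denq_neq0.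
suff H t : exists z : int, z%:~R = (\prod_t `|denq (f t)|)%N%:R * f t.
  by have /fin_all_exists[g gE] := H; exists g.
rewrite (bigD1 t) //= natrM mulrAC.
exists ((\prod_(i | i != t) `|denq (f i)|)%N%:Z * numq (f t)).
have -> : `|denq (f t)|%:R = (denq (f t))%:~R :> rat by rewrite pmulrn gez0_abs.
rewrite intrM numqE -pmulrn; ring.
Qed.

(** * Algebraic dependence and elimination *)

(** More rows than columns force a linear relation between the rows. *)
Lemma counting_relation (C : fieldType) (A B : finType) (f : A -> B -> C) :
  (#|B| < #|A|)%N -> exists2 h : A -> C, exists a, h a != 0 &
  forall b, \sum_a h a * f a b = 0.
Proof.
move=> ltBA; pose M : 'M[C]_(#|A|, #|B|) := \matrix_(i, j) f (enum_val i) (enum_val j).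
have : kermx M != 0.
  rewrite kermx_eq0 /row_free; apply: contraTneq ltBA => rM.
  by rewrite -leqNgt -rM rank_leq_col.
move/rowV0Pn => [v /sub_kermxP vM v0].
exists (fun a => v 0 (enum_rank a)).
  have /rV0Pn[i vi] := v0; by exists (enum_val i); rewrite enum_valK.
move=> b; have /rowP/(_ (enum_rank b)) := vM.
rewrite !mxE => vM0; rewrite -[RHS]vM0 (reindex _ (onW_bij _ (enum_val_bij A))) /=.
by apply: eq_bigr => i _; rewrite !mxE enum_valK enum_rankK.
Qed.

Lemma msizeX_le (C : idomainType) M D (p : {mpoly C[M]}) n :
  (msize p <= D.+1)%N -> (msize (p ^+ n) <= (n * D).+1)%N.
Proof.
move=> pD; elim: n => [|n IH]; first by rewrite expr0 msize1.
rewrite exprS; have [->|pn0] := eqVneq p 0; first by rewrite mul0r msize0.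
have [->|pn1] := eqVneq (p ^+ n) 0; first by rewrite mulr0 msize0.
rewrite msizeM //; lia.
Qed.

Lemma msizeM_le2 (C : idomainType) M D E (p q : {mpoly C[M]}) :
  (msize p <= D.+1)%N -> (msize q <= E.+1)%N -> (msize (p * q)%R <= (D + E).+1)%N.
Proof.
have [->|p0] := eqVneq p 0; first by rewrite mul0r msize0.
have [->|q0] := eqVneq q 0; first by rewrite mulr0 msize0.
rewrite msizeM //; lia.
Qed.

Lemma msize_prodX_le (C : idomainType) M D (I : finType)
    (P : I -> {mpoly C[M]}) (al : I -> nat) :
  (forall i, (msize (P i) <= D.+1)%N) ->
  (msize (\prod_i P i ^+ al i)%R <= ((\sum_i al i) * D).+1)%N.
Proof.
move=> PD; elim/big_rec2: _ => [|i n p _ IH]; first by rewrite msize1.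
by rewrite mulnDl; apply: msizeM_le2 => //; apply: msizeX_le.
Qed.

(** The products of powers of the P i with exponents less than e, homogenized by
    powers of Q, are e ^ N polynomials in a space of dimension O(e ^ M). *)
Lemma algebraic_dependence (C : fieldType) M N (P : 'I_N -> {mpoly C[M]})
    (Q : {mpoly C[M]}) : (M < N)%N ->
  exists2 H : {mpoly C[N]}, H != 0 &
    forall z, Q.@[z] != 0 -> H.@[fun i => (P i).@[z] / Q.@[z]] = 0.
Proof.
move=> ltMN.
pose D := maxn (\max_i msize (P i)) (msize Q).
have PD i : (msize (P i) <= D.+1)%N.
  by rewrite ltnW // ltnS leq_max (leq_bigmax i).
have QD : (msize Q <= D.+1)%N by rewrite ltnW // ltnS leq_maxr.
(* With this e, (N e D + 1) ^ M <= e ^ M (N D + 1) ^ M < e ^ M e <= e ^ N. *)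
pose e := ((N * D).+1 ^ M).+1.
pose T (al : {ffun 'I_N -> 'I_e}) : {mpoly C[M]} :=
  Q ^+ (N * e - \sum_i al i) * \prod_i P i ^+ al i.
have sum_al (al : {ffun 'I_N -> 'I_e}) : (\sum_i al i <= N * e)%N.
  rewrite -[N in (N * e)%N]card_ord -sum_nat_const leq_sum // => i _; exact: ltnW.
have T_size al : (msize (T al) <= (N * e * D).+1)%N.
  apply: leq_trans (msizeM_le2 (msizeX_le _ QD) (msize_prodX_le _ PD)) _.
  by rewrite -mulnDl subnK.
pose mn (be : {ffun 'I_M -> 'I_(N * e * D).+1}) : 'X_{1..M} :=
  [multinom be i : nat | i < M].
have [|h [a0 ha0] hT] := counting_relation (fun al be => (T al)@_(mn be)).
  rewrite !card_ffun !card_ord.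
  have le1 : ((N * e * D).+1 <= e * (N * D).+1)%N by lia.
  apply: (@leq_ltn_trans ((e * (N * D).+1) ^ M)).
    by case: (M) => // n; rewrite leq_exp2r.
  have -> : (e ^ N = e ^ M * e ^ (N - M))%N by rewrite -expnD subnKC // ltnW.
  rewrite expnMn ltn_mul2l expn_gt0 /=; apply: (@leq_trans e) => //.
  by rewrite -[X in (X <= _)%N]expn1 leq_pexp2l // subn_gt0.
have hT0 : \sum_al h al *: T al = 0.
  apply/mpolyP => m; rewrite mcoeff0 raddf_sum /=.
  under eq_bigr do rewrite mcoeffZ.
  have [mD|Dm] := leqP (mdeg m) (N * e * D).
    have lt i : (m i < (N * e * D).+1)%N.
      by rewrite ltnS (leq_trans _ mD) // mdegE (bigD1 i) //= leq_addr.
    pose be := [ffun i => Ordinal (lt i)].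
    have -> : m = mn be by apply/mnmP => i; rewrite mnmE ffunE.
    exact: hT.
  rewrite big1 // => al _; rewrite memN_msupp_eq0 ?mulr0 //.
  exact: msize_mdeg_ge (leq_trans (T_size _) Dm).
pose mN (al : {ffun 'I_N -> 'I_e}) : 'X_{1..N} := [multinom al i : nat | i < N].
have mN_inj : injective mN.
  move=> al be /mnmP E; apply/ffunP => i; apply: val_inj.
  by have := E i; rewrite !mnmE.
exists (\sum_al h al *: 'X_[mN al]).
  apply: contra_neq ha0 => /mpolyP/(_ (mN a0)).
  rewrite mcoeff0 raddf_sum /= (bigD1 a0) //= mcoeffZ mcoeffX eqxx mulr1 big1 ?addr0 //.
  by move=> al /negPf ne; rewrite mcoeffZ mcoeffX (inj_eq mN_inj) ne mulr0.
move=> z Qz; apply: (mulfI (expf_neq0 (N * e) Qz)).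
rewrite mulr0 -[RHS](@meval0 _ _ z) -hT0 !raddf_sum /= mulr_sumr.
apply: eq_bigr => al _; rewrite !mevalZ mulrCA; congr (_ * _).
rewrite mevalX mevalM rmorphXn rmorph_prod /=.
under [in LHS]eq_bigr do rewrite mnmE expr_div_n.
have -> : \prod_i (P i ^+ al i).@[z] = \prod_i (P i).@[z] ^+ al i.
  by apply: eq_bigr => i _; rewrite rmorphXn.
rewrite prodf_div mulrA mulrAC.
congr (_ * _); rewrite prodrXr; apply: (canLR (mulfK (expf_neq0 _ Qz))).
by rewrite -exprD subnK.
Qed.

(** Up to multiplication by a common q, integral vectors in V are integral combinations of \dim V
    integral vectors.  So, after extraction of q-th roots of the variables,
    monomials with exponents in V become monomials in \dim V variables. *)
Lemma lattice_factorization (T : finType) k (V : {vspace 'rV[rat]_k})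
    (e : T -> 'rV[int]_k) :
  (forall t, map_mx intr (e t) \in V) ->
  exists2 q : nat, (0 < q)%N & exists (B : 'M[int]_(\dim V, k))
    (g : T -> 'rV[int]_(\dim V)), forall t, q%:Z *: e t = g t *m B.
Proof.
move=> eV; pose b := vbasis V.
have [q1 q1_gt0 [g gE]] := clear_denominators
  (fun p : T * 'I_(\dim V) => coord b p.2 (map_mx intr (e p.1))).
have [q2 q2_gt0 [B BE]] := clear_denominators
  (fun p : 'I_(\dim V) * 'I_k => (b`_p.1 : 'rV_k) 0 p.2).
exists (q1 * q2)%N; first by rewrite muln_gt0 q1_gt0.
exists (\matrix_(i, j) B (i, j)), (fun t => \row_i g (t, i)) => t.
apply/rowP => j; rewrite !mxE; apply: (@intr_inj rat).
have /rowP/(_ j) := coord_vbasis (eV t).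
rewrite !mxE rmorphM /= => ->; rewrite raddf_sum /= summxE mulr_sumr.
apply: eq_bigr => i _; rewrite !mxE [RHS]intrM gE BE /= -pmulrn natrM /b.
ring.
Qed.

(** The coefficients c that solve such a system depend on the c a for a outside
    K and on the \dim V independent monomials, which makes fewer than N
    parameters. *)
Lemma torus_elimination (C : closedFieldType) N k (K : {set 'I_N})
    (lam : 'I_N -> 'I_N -> C) (e : 'I_N -> 'I_N -> 'rV[int]_k)
    (V : {vspace 'rV[rat]_k}) :
  (forall j a, j \in K -> a \notin K -> map_mx intr (e j a) \in V) ->
  (\dim V < #|K|)%N ->
  generically (fun c : 'I_N -> C => ~ exists2 y : 'I_k -> C, torus y &
    forall j, j \in K ->
      c j = \sum_(a | a \notin K) lam j a * c a * tmon y (e j a)).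
Proof.
move=> eV dV; pose d := \dim V; pose m := #|~: K|.
pose lam' j a := if j \in K then lam j a else (a == j)%:R.
pose e' (p : 'I_N * 'I_N) := if (p.1 \in K) && (p.2 \notin K) then e p.1 p.2 else 0.
have [|q q_gt0 [B [g gE]]] := @lattice_factorization _ _ V e'.
  move=> [j a]; rewrite /e' /=; case: ifP => [/andP[]|_]; first exact: eV.
  by rewrite raddf0 mem0v.
(* Multiplying by Q, with exponents G, clears the negative exponents. *)
pose u p i : int := g p 0 i.
pose G := (\max_p \max_i `|u p i|)%N.
have gG p i : 0 <= g p 0 i + G%:Z.
  rewrite -/(u p i); have: (`|u p i| <= G)%N.
    apply: (leq_trans (leq_bigmax (F := fun i => `|u p i|%N) i)).
    exact: (leq_bigmax (F := fun p => \max_i `|u p i|%N) p).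
  lia.
pose Q : {mpoly C[m + d]} := \prod_i 'X_(rshift m i) ^+ G.
pose P (j : 'I_N) : {mpoly C[m + d]} := \sum_(t < m) lam' j (enum_val t) *:
  ('X_(lshift d t) * \prod_i 'X_(rshift m i) ^+ `|g (j, enum_val t) 0 i + G%:Z|).
have [|H H0 HP] := algebraic_dependence P Q.
  have := cardsC K; rewrite card_ord -/m -/d => <-; rewrite addnC ltn_add2r //.
exists H => // c; apply: contraNnot => -[y y0 yP]; apply/eqP.
have [x x0 xE] := torus_root q_gt0 y0.
pose Y i := tmon x (row i B).
have Y0 i : Y i != 0 by exact: tmon_neq0.
pose z (s : 'I_(m + d)) := match split s with inl t => c (enum_val t) | inr i => Y i end.
have zl t : z (lshift d t) = c (enum_val t) by rewrite /z (unsplitK (inl t)).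
have zr t : z (rshift m t) = Y t by rewrite /z (unsplitK (inr t)).
have QE : Q.@[z] = \prod_i Y i ^+ G.
  by rewrite rmorph_prod /=; apply: eq_bigr => i _; rewrite rmorphXn /= mevalXU zr.
have Q0 : Q.@[z] != 0 by rewrite QE; apply/prodf_neq0 => i _; rewrite expf_neq0.
rewrite -(HP z Q0); apply: meval_eq => j; apply: (canRL (mulfK Q0)).
have -> : c j = \sum_(a in ~: K) lam' j a * c a * tmon y (e' (j, a)).
  rewrite /lam' /e' /=; case: (boolP (j \in K)) => jK /=.
    by rewrite yP //; apply: eq_big => [a|a aK]; rewrite ?inE // aK.
  rewrite (bigD1 j) ?inE //= tmon0 eqxx mul1r mulr1 big1 ?addr0 //.
  by move=> a /andP[_ /negPf->]; rewrite !mul0r.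
rewrite big_enum_val mulr_suml raddf_sum; apply: eq_bigr => t _ /=.
rewrite mevalZ mevalM mevalXU zl -!mulrA; congr (_ * (_ * _)).
have -> : tmon y (e' (j, enum_val t)) = \prod_i Y i ^ g (j, enum_val t) 0 i.
  transitivity (tmon x (q%:Z *: e' (j, enum_val t))).
    by rewrite tmonZ; apply: eq_bigr => i _; rewrite xE.
  by rewrite gE -tmon_comp.
rewrite QE rmorph_prod -big_split; apply: eq_bigr => i _ /=.
rewrite rmorphXn /= mevalXU zr !exprnP -expfzDr //; congr (_ ^ _).
by rewrite gez0_abs.
Qed.

(** * The theorem of Rado on independent transversals *)

Section Rado.
Variables (F : fieldType) (vT : vectType F) (L J : finType).
Variables (w : L -> J -> vT).
Implicit Types (S : L -> {set J}) (T : {set L}).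

Definition famspan S T : {vspace vT} := (\sum_(l in T) \sum_(j in S l) <[w l j]>)%VS.

Lemma famspan_subv S T (U : {vspace vT}) :
  (forall l j, l \in T -> j \in S l -> w l j \in U) -> (famspan S T <= U)%VS.
Proof.
move=> sU; apply/subv_sumP => l lT; apply/subv_sumP => j jS.
by rewrite -memvE sU.
Qed.

Lemma mem_famspan S T l j : l \in T -> j \in S l -> w l j \in famspan S T.
Proof.
move=> lT jS; rewrite memvE; apply: (subv_trans _ (sumv_sup l lT (subvv _))).
exact: (sumv_sup j jS (subvv _)).
Qed.

Definition hall S (L0 : {set L}) : Prop :=
  forall T, T \subset L0 -> (#|T| <= \dim (famspan S T))%N.

(** Remove elements from the sets S l one at a time.  If both the removal of x
    and that of y from S l0 destroyed the condition of Hall, on T1 and T2, then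
    the modular law for the two spans, applied to T1 :|: T2 and to
    T1 :&: T2 without l0, would contradict the condition for S.  The element j0
    only provides a value of f outside L0. *)
Lemma rado (j0 : J) (L0 : {set L}) S : hall S L0 ->
  exists2 f : L -> J, forall l, l \in L0 -> f l \in S l &
    (#|L0| <= \dim (\sum_(l in L0) <[w l (f l)]>)%VS)%N.
Proof.
elim: {S}_.+1 {-2}S (ltnSn (\sum_(l in L0) #|S l|)) => // n IH S.
rewrite ltnS => Sn hS.
have S_gt0 l : l \in L0 -> (0 < #|S l|)%N.
  move=> lL; have := hS [set l]; rewrite sub1set cards1 => /(_ lL).
  rewrite card_gt0; apply: contraTneq => S0; rewrite -ltnNge ltnS leqn0 dimv_eq0 -subv0.
  by apply: famspan_subv => l' j /set1P->; rewrite S0 inE.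
have [/existsP[l0 /andP[l0L S2]]|/existsPn S1] := boolP [exists l in L0, (1 < #|S l|)%N].
  have [x [y [xS yS xy]]] := card_gt1P S2.
  pose del z l := if l == l0 then S l :\ z else S l.
  have del_sum z : z \in S l0 -> (\sum_(l in L0) #|del z l| < n)%N.
    move=> zS; apply: leq_trans Sn; rewrite (bigD1 l0) //= [X in (_ < X)%N](bigD1 l0) //=.
    rewrite -addSn leq_add //; first by rewrite /del eqxx [X in (_ < X)%N](cardsD1 z) zS.
    by apply: leq_sum => l /andP[_ /negPf ne]; rewrite /del ne.
  have del_sub z l : del z l \subset S l.
    by rewrite /del; case: eqP => // _; rewrite subD1set.
  have hallE S' : hall S' L0 \/
      exists2 T : {set L}, T \subset L0 & (\dim (famspan S' T) < #|T|)%N.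
    have [/existsP[T /andP[TL lt]]|/existsPn h] :=
      boolP [exists T : {set L}, (T \subset L0) && (\dim (famspan S' T) < #|T|)%N].
      by right; exists T.
    by left=> T TL; have := h T; rewrite TL /= -leqNgt.
  have done z : z \in S l0 -> hall (del z) L0 ->
      exists2 f : L -> J, forall l, l \in L0 -> f l \in S l &
      (#|L0| <= \dim (\sum_(l in L0) <[w l (f l)]>)%VS)%N.
    move=> /del_sum lt h; have [f fS fd] := IH _ lt h; exists f => // l /fS.
    exact: (subsetP (del_sub z l)).
  have [|[T1 T1L d1]] := hallE (del x); first exact: done.
  have [|[T2 T2L d2]] := hallE (del y); first exact: done.
  have l0T z T : T \subset L0 -> (\dim (famspan (del z) T) < #|T|)%N -> l0 \in T.
    move=> TL; apply: contraTT => l0T; rewrite -leqNgt (leq_trans (hS T TL)) // dimvS //.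
    apply: famspan_subv => l j lT jS; apply: mem_famspan => //.
    by rewrite /del ifN // (memPn l0T).
  have l1 := l0T _ _ T1L d1; have l2 := l0T _ _ T2L d2.
  have hU := hS (T1 :|: T2); rewrite subUset T1L T2L in hU.
  have hI := hS ((T1 :&: T2) :\ l0).
  rewrite (subset_trans (subD1set _ _) (subset_trans (subsetIl _ _) T1L)) in hI.
  have /dimvS sU : (famspan S (T1 :|: T2) <= famspan (del x) T1 + famspan (del y) T2)%VS.
    apply: famspan_subv => l j lT jS.
    have sub1 : l \in T1 -> j \in del x l ->
        w l j \in (famspan (del x) T1 + famspan (del y) T2)%VS.
      by move=> lT1 jd; apply: subvP (mem_famspan lT1 jd); exact: addvSl.
    have sub2 : l \in T2 -> j \in del y l ->
        w l j \in (famspan (del x) T1 + famspan (del y) T2)%VS.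
      by move=> lT2 jd; apply: subvP (mem_famspan lT2 jd); exact: addvSr.
    have [ll|ne] := eqVneq l l0; last first.
      by move: lT; rewrite inE => /orP[] lT; [apply: sub1|apply: sub2];
        rewrite // /del (negPf ne).
    have [jx|nx] := eqVneq j x.
      by apply: sub2; rewrite ?ll // /del eqxx !inE jx xy -?ll -?jx.
    by apply: sub1; rewrite ?ll // /del eqxx !inE nx -ll.
  have /dimvS sI : (famspan S ((T1 :&: T2) :\ l0) <=
      famspan (del x) T1 :&: famspan (del y) T2)%VS.
    apply: famspan_subv => l j; rewrite !inE => /and3P[/negPf ne lT1 lT2] jS.
    by rewrite memv_cap !mem_famspan // /del ne.
  have := dimv_sum_cap (famspan (del x) T1) (famspan (del y) T2).
  have := cardsUI T1 T2; have := cardsD1 l0 (T1 :&: T2); rewrite inE l1 l2 /=.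
  have {}hU := leq_trans (hU isT) sU; have {}hI := leq_trans (hI isT) sI.
  move: d1 d2 hU hI; set U1 := famspan _ T1; set U2 := famspan _ T2; lia.
have Sc l : l \in L0 -> #|S l| == 1%N.
  by move=> lL; rewrite eqn_leq S_gt0 // andbT leqNgt; have := S1 l; rewrite lL.
pose f l := odflt j0 [pick j in S l].
have fE l : l \in L0 -> S l = [set f l].
  move=> /Sc/cards1P[j Sj]; rewrite /f.
  by case: pickP => [i|/(_ j)]; rewrite Sj inE ?eqxx // => /eqP->.
exists f => [l /fE->|]; first by rewrite inE.
apply: leq_trans (hS L0 (subxx _)) (dimvS _).
apply: famspan_subv => l j lL; rewrite fE // inE => /eqP->.
by rewrite memvE (sumv_sup l).
Qed.
End Rado.

(** * Binomial systems, and points where a polynomial does not vanish *)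

(** The coordinate forms in the basis of the w l, with denominators cleared. *)
Lemma dual_basis k (T : finType) (L0 : {set T}) (w : T -> 'rV[int]_k) :
  (#|L0| <= \dim (\sum_(l in L0) <[map_mx intr (w l) : 'rV[rat]_k]>)%VS)%N ->
  exists2 q : nat, (0 < q)%N & exists B : T -> 'cV[int]_k,
    forall l l', l \in L0 -> l' \in L0 -> w l *m B l' = (q%:Z *+ (l == l'))%:M.
Proof.
move=> dL; pose X := [tuple of [seq (map_mx intr (w l) : 'rV[rat]_k) | l <- enum L0]].
have fX : free X.
  by rewrite /free eqn_leq dim_span size_tuple span_def big_map big_enum.
pose i (l : T) : nat := index l (enum L0).
have iL l : l \in L0 -> (i l < #|L0|)%N by rewrite cardE index_mem mem_enum.
have Xi l : l \in L0 -> X`_(i l) = map_mx intr (w l).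
  by move=> lL; rewrite (nth_map l) -?cardE ?iL // nth_index // mem_enum.
pose cf l (v : 'rV[rat]_k) := if insub (i l) is Some j then coord X j v else 0.
have cfE l l' : l \in L0 -> l' \in L0 -> cf l' (map_mx intr (w l)) = (l == l')%:R.
  move=> lL lL'; rewrite /cf insubT ?iL // => lt.
  rewrite -Xi // -[i l]/(nat_of_ord (Ordinal (iL _ lL))) coord_free //= -val_eqE /= /i.
  case: (eqVneq l l') => [->|ne]; first by rewrite eqxx.
  by case: eqP => // /index_inj E; rewrite E ?mem_enum ?eqxx in ne.
have [q q0 [g gE]] := clear_denominators (fun p : T * 'I_k => cf p.1 (delta_mx 0 p.2)).
exists q => //; exists (fun l => \col_j g (l, j)) => l l' lL lL'.
apply/matrixP => a b; rewrite !ord1 !mxE eqxx mulr1n; apply: (@intr_inj rat).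
transitivity (q%:R * cf l' (map_mx intr (w l))); last first.
  by rewrite cfE // mulr_natr rmorphMn /= -pmulrn.
rewrite [X in cf _ X]row_sum_delta raddf_sum /=.
have cfS (I : finType) (f : I -> rat) (v : I -> 'rV_k) :
    cf l' (\sum_t f t *: v t) = \sum_t f t * cf l' (v t).
  rewrite /cf insubT ?iL // => lt; rewrite linear_sum; apply: eq_bigr => t _.
  by rewrite linearZ.
rewrite cfS mulr_sumr; apply: eq_bigr => t _.
rewrite !mxE rmorphM /= gE /=; ring.
Qed.

(** Integral vectors q-dual to the exponents turn the system into the
    extraction of q-th roots of the right-hand sides. *)
Lemma binomial_system (C : closedFieldType) k (T : finType) (L0 : {set T})
    (w : T -> 'rV[int]_k) (b : T -> C) :
  (#|L0| <= \dim (\sum_(l in L0) <[map_mx intr (w l) : 'rV[rat]_k]>)%VS)%N ->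
  (forall l, b l != 0) ->
  exists2 y : 'I_k -> C, torus y & forall l, l \in L0 -> tmon y (w l) = b l.
Proof.
move=> /dual_basis[q q0 [B BE]] b0.
have /fin_all_exists[z zE] l := nat_root (b l) q0.
have z0 l : z l != 0.
  by apply: contraNneq (b0 l) => zl; rewrite -(zE l) zl exp0rz eqz_nat (gtn_eqF q0).
exists (fun c => \prod_(l in L0) z l ^ B l c 0).
  by move=> c; apply/prodf_neq0 => l _; rewrite expfz_neq0.
move=> l lL; rewrite /tmon.
have E c : (\prod_(l in L0) z l ^ B l c 0) ^ w l 0 c =
    \prod_(l' in L0) z l' ^ (w l 0 c * B l' c 0).
  elim/big_rec2: _ => [|l' u v _ <-]; first by rewrite exp1rz.
  by rewrite expfzMl exprz_exp [w l 0 c * _]mulrC.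
under eq_bigr do rewrite E.
rewrite exchange_big /= -(zE l) (bigD1 l) //= [X in _ * X]big1 ?mulr1
  => [|l' /andP[lL' ne]].
  have := BE l l lL lL; rewrite eqxx mulr1n => /matrixP/(_ 0 0).
  rewrite !mxE eqxx mulr1n => <-.
  by elim/big_rec2: _ => [|c u v _ ->]; rewrite ?expr0z // expfzDr.
have := BE l l' lL lL'; rewrite eq_sym (negPf ne) mulr0n => /matrixP/(_ 0 0).
rewrite !mxE mul0rn => H; transitivity (z l' ^ (0 : int)) => //; rewrite -H.
by elim/big_rec2: _ => [|c u v _ ->]; rewrite ?expr0z // expfzDr.
Qed.

Lemma base_expansion_inj n D (m m' : 'I_n -> nat) :
  (forall i, m i < D)%N -> (forall i, m' i < D)%N ->
  (\sum_i m i * D ^ i = \sum_i m' i * D ^ i)%N -> m =1 m'.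
Proof.
elim: n m m' => [|n IH] m m' mD mD'; first by move=> _ [].
have D0 : (0 < D)%N by apply: leq_trans (mD ord0).
have E (u : 'I_n.+1 -> nat) : (\sum_i u i * D ^ i =
    (\sum_(i < n) u (lift ord0 i) * D ^ i) * D + u ord0)%N.
  rewrite big_ord_recl expn0 muln1 addnC big_distrl /=; congr (_ + _)%N.
  by apply: eq_bigr => i _; rewrite -mulnA -expnSr.
rewrite !E => eqm.
have e0 : m ord0 = m' ord0.
  by have /(congr1 (modn^~ D)) := eqm; rewrite /= !modnMDl !modn_small.
have eS : (\sum_(i < n) m (lift ord0 i) * D ^ i = \sum_(i < n) m' (lift ord0 i) * D ^ i)%N.
  by have /(congr1 (divn^~ D)) := eqm; rewrite /= !divnMDl // !divn_small // !addn0.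
move=> i; case: (unliftP ord0 i) => [j ->|-> //].
exact: (IH (fun j => m (lift ord0 j)) (fun j => m' (lift ord0 j))).
Qed.

Lemma poly_nonroot (C : closedFieldType) (p : {poly C}) : p != 0 ->
  exists2 x, x != 0 & p.[x] != 0.
Proof.
move=> p0; have pX : p * 'X != 0 by rewrite mulf_neq0 ?polyX_eq0.
have [x] := PreClosedField.closed_nonrootP (@solve_monicpoly C) _ pX.
rewrite /root hornerM hornerX mulf_eq0 negb_or => /andP[px x0].
by exists x.
Qed.

(** Substitution of t ^ (D ^ i) for the i-th variable, with D larger than the
    degree, keeps distinct monomials distinct. *)
Lemma torus_nonvanishing (C : closedFieldType) N (H : {mpoly C[N]}) : H != 0 ->
  exists2 x : 'I_N -> C, torus x & H.@[x] != 0.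
Proof.
move=> H0; pose D := msize H.
pose kap (m : 'X_{1..N}) := (\sum_i m i * D ^ i)%N.
have kap_inj : {in msupp H &, injective kap}.
  have lt m i : m \in msupp H -> (m i < D)%N.
    by move/msize_mdeg_lt; apply: leq_ltn_trans; rewrite mdegE (bigD1 i) //= leq_addr.
  move=> m m' mH mH' E; apply/mnmP => i.
  by apply: (base_expansion_inj (D := D)) E _ => j; apply: lt.
pose p : {poly C} := \sum_(m <- msupp H) H@_m *: 'X^(kap m).
have [t t0 pt] : exists2 t, t != 0 & p.[t] != 0.
  apply: poly_nonroot; have m0H := mlead_supp H0.
  apply: contra_neq (_ : H@_(mlead H) != 0); last by rewrite -mcoeff_msupp.
  move/polyP/(_ (kap (mlead H))); rewrite coef0 coef_sum (bigD1_seq (mlead H)) //=.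
  rewrite coefZ coefXn eqxx mulr1 big_seq_cond big1 ?addr0 // => m /andP[mH ne].
  by rewrite coefZ coefXn (inj_in_eq kap_inj) // eq_sym (negPf ne) mulr0.
exists (fun i => t ^+ (D ^ i)) => [i|]; first by rewrite expf_neq0.
suff <- : p.[t] = H.@[fun i => t ^+ (D ^ i)] by [].
rewrite mevalE horner_sum; apply: eq_bigr => m _; rewrite hornerZ hornerXn; congr (_ * _).
by rewrite -prodrXr; apply: eq_bigr => i _; rewrite mulnC exprM.
Qed.

(** * Systems of equations with given supports *)

Section SparseSystems.
Variables (C : closedFieldType) (N k : nat) (L : finType).
Variables (a : 'I_N -> 'X_{1..k}) (S : L -> {set 'I_N}).

Definition blocksum (c : 'I_N -> C) (y : 'I_k -> C) (B : {set 'I_N}) : C :=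
  \sum_(j in B) c j * tmon y (divm (a j)).

Definition solvable (c : 'I_N -> C) : Prop :=
  exists2 y, torus y & forall l, blocksum c y (S l) = 0.

Lemma holds_conj (T : eqType) (s : seq T) (F : T -> GRing.formula C) e :
  GRing.holds e (foldr (fun t g => GRing.And (F t) g) (GRing.Bool true) s) <->
  forall t, t \in s -> GRing.holds e (F t).
Proof.
elim: s => [|t s IH] //=; split=> [[Ft /IH Fs] u|Fs].
  by rewrite in_cons => /predU1P[->|/Fs].
split; first by apply: Fs; rewrite mem_head.
by apply/IH => u us; apply: Fs; rewrite in_cons us orbT.
Qed.

Lemma eval_sum T (s : seq T) (F : T -> GRing.term C) e :
  GRing.eval e (foldr (fun t g => GRing.Add (F t) g) (GRing.NatConst C 0) s) =
  \sum_(t <- s) GRing.eval e (F t).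
Proof. by elim: s => [|t s IH] /=; rewrite ?big_nil // big_cons IH. Qed.

Lemma eval_prod T (s : seq T) (F : T -> GRing.term C) e :
  GRing.eval e (foldr (fun t g => GRing.Mul (F t) g) (GRing.NatConst C 1) s) =
  \prod_(t <- s) GRing.eval e (F t).
Proof. by elim: s => [|t s IH] /=; rewrite ?big_nil // big_cons IH. Qed.

Lemma solvable_dichotomy :
  generically solvable \/ generically (fun c => ~ solvable c).
Proof.
pose X i := GRing.Var C i.
pose mon j := foldr (fun i : 'I_k => GRing.Mul (GRing.Exp (X (N + i)%N) (a j i)))
  (GRing.NatConst C 1) (enum 'I_k).
pose term (j : 'I_N) := GRing.Mul (X j) (mon j).
pose total l := foldr (fun j => GRing.Add (term j)) (GRing.NatConst C 0) (enum (S l)).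
pose zero t := GRing.Equal t (GRing.NatConst C 0).
pose ff := exists_vars N k (GRing.And
  (foldr (fun i : 'I_k => GRing.And (GRing.Not (zero (X (N + i)%N))))
    (GRing.Bool true) (enum 'I_k))
  (foldr (fun l => GRing.And (zero (total l))) (GRing.Bool true) (enum L))).
have szE (c : 'I_N -> C) : size (env c) = N by rewrite size_map size_enum_ord.
have ffE (c : 'I_N -> C) : GRing.holds (env c) ff <-> solvable c.
  rewrite holds_exists_vars /=.
  have nthc y (j : 'I_N) : (env c ++ env (y : 'I_k -> C))`_j = c j.
    by rewrite nth_cat szE ltn_ord nth_env.
  have nthy y (i : 'I_k) : (env c ++ env (y : 'I_k -> C))`_(N + i) = y i.
    by rewrite nth_cat szE ltnNge leq_addr /= addKn nth_env.
  have sumE (y : 'I_k -> C) l :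
      \sum_(j <- enum (S l)) GRing.eval (env c ++ env y) (term j) = blocksum c y (S l).
    rewrite big_enum; apply: eq_bigr => j _; rewrite /= nthc; congr (_ * _).
    rewrite eval_prod big_enum; by apply: eq_bigr => i _ /=; rewrite nthy mxE.
  split=> [[y [/holds_conj yt /holds_conj ys]]|[y yt ys]]; exists y.
  - by move=> i; have := yt i (mem_enum _ _); rewrite /= nthy => /eqP.
  - move=> l; have := ys l (mem_enum _ _); rewrite -sumE /= eval_sum => ->.
    by [].
  split; apply/holds_conj => x _ /=; last by rewrite eval_sum sumE ys.
  by rewrite nthy; apply/eqP/yt.
have [gen|gen] := formula_dichotomy N ff; [left|right]; apply: generically_imp gen => c.
  by move/ffE.
by move=> nf /ffE.
Qed.

Definition ratexp (m : 'X_{1..k}) : 'rV[rat]_k := map_mx intr (divm m).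

(** The strict bound on the dimension forces T to be non-empty. *)
Definition dependent_blocks : Prop :=
  exists (T : {set L}) (V : {vspace 'rV[rat]_k}),
    [/\ forall l, l \in T -> S l != set0,
        forall l j j', l \in T -> j \in S l -> j' \in S l ->
          ratexp (a j) - ratexp (a j') \in V &
        (\dim V < #|T|)%N].

Hypothesis disjS : forall l l' j, j \in S l -> j \in S l' -> l = l'.

(** A solution y determines, for each l in T, one coefficient of the l-th
    equation from the others and from monomials with exponents in V. *)
Lemma dependent_unsolvable : dependent_blocks ->
  generically (fun c => ~ solvable c).
Proof.
case=> T [V [Sn0 SV dV]].
have [L0|[l0 l0T]] := set_0Vmem T; first by rewrite L0 cards0 in dV.
have [j0 _] := set0Pn _ (Sn0 _ l0T).
pose m l := odflt j0 [pick j in S l].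
have mS l : l \in T -> m l \in S l.
  by move=> /Sn0/set0Pn[j jS]; rewrite /m; case: pickP => // /(_ j); rewrite jS.
(* The coefficient of index m l is the one that is solved for. *)
pose K := m @: T.
have m_inj : {in T &, injective m}.
  by move=> l l' lT lT' E; apply: (disjS (mS l lT)); rewrite E mS.
have SK l j : l \in T -> j \in S l -> (j \in K) = (j == m l).
  move=> lT jS; apply/imsetP/eqP => [[l' lT' jE]|->]; last by exists l.
  by rewrite jE; congr m; apply: (disjS _ jS); rewrite jE mS.
pose same j b := [exists l in T, (j \in S l) && (b \in S l)].
have sameP l j : l \in T -> j \in S l -> same j =1 mem (S l).
  move=> lT jS b; apply/existsP/idP => [[l' /and3P[_ jS' bS]]|bS].
    by rewrite (disjS jS jS').
  by exists l; rewrite lT jS.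
have := @torus_elimination C N k K (fun j b => - (same j b)%:R)
  (fun j b => if same j b then divm (a b) - divm (a j) else 0) V.
rewrite card_in_imset // => /(_ _ dV) elim; apply: generically_imp (elim _)
  => [c nc [y y0 ys]|j b _ _].
  apply: nc; exists y => // j /imsetP[l lT ->].
  have t0 := tmon_neq0 (divm (a (m l))) y0.
  apply: (mulIf t0); apply/eqP; rewrite -subr_eq0 mulr_suml -sumrN; apply/eqP.
  rewrite -[RHS](ys l) /blocksum [RHS](bigD1 (m l)) ?mS //=; congr (_ + _).
  rewrite [RHS](eq_bigl (fun b => (b \notin K) && (b \in S l))); last first.
    move=> b; case: (boolP (b \in S l)) => bS; rewrite ?andbF //= andbT.
    by rewrite (SK l).
  rewrite big_mkcondr; apply: eq_bigr => b bK; rewrite (sameP l) ?mS // /=.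
  case: ifP => bS; rewrite ?oppr0 ?mul0r ?oppr0 //.
  by rewrite -!mulrA mulN1r opprK -tmonD // subrK.
case: ifP => [/existsP[l /and3P[lT jS bS]]|_]; last by rewrite raddf0 mem0v.
by rewrite raddfB /= (SV l).
Qed.

End SparseSystems.

Section WeightedTop.
Variable C : fieldType.

(** Here d is a bound for the degree, and t may be zero. *)
Definition topcoef (p : {poly C}) d t := (size p <= d.+1)%N /\ p`_d = t.

Lemma topcoefM p q d e t u :
  topcoef p d t -> topcoef q e u -> topcoef (p * q) (d + e) (t * u).
Proof.
move=> [pd <-] [qe <-]; split.
  by rewrite (leq_trans (size_polyMleq _ _)) //; lia.
have dlt : (d < (d + e).+1)%N by rewrite ltnS leq_addr.
rewrite coefM (bigD1 (Ordinal dlt)) //= addKn big1 ?addr0 // => i ne.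
have [lt|le] := ltnP d i; first by rewrite [p`_i]nth_default ?mul0r // (leq_trans pd).
have {le}lt : (i < d)%N by rewrite ltn_neqAle le andbT; exact: ne.
by rewrite [q`_(_)]nth_default ?mulr0 // (leq_trans qe) //; lia.
Qed.

Lemma topcoefX p d t n : topcoef p d t -> topcoef (p ^+ n) (n * d) (t ^+ n).
Proof.
move=> pd; elim: n => [|n IH]; first by split; rewrite ?expr0 ?size_poly1 ?coef1.
by rewrite !exprS mulSn; apply: topcoefM.
Qed.

Lemma topcoef_prod (I : finType) (p : I -> {poly C}) d t :
  (forall i, topcoef (p i) (d i) (t i)) ->
  topcoef (\prod_i p i) (\sum_i d i) (\prod_i t i).
Proof.
move=> pd; elim/big_rec3: _ => [|i q e u _ IH]; last exact: topcoefM.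
by split; rewrite ?size_poly1 ?coef1.
Qed.

(** The part of H of maximal weight D gives the coefficient of degree D after
    substitution of polynomials of degrees at most the weights. *)
Lemma topcoef_comp N (H : {mpoly C[N]}) (wgt : 'I_N -> nat) (x : 'I_N -> C)
    (P : 'I_N -> {poly C}) D :
  (forall i, topcoef (P i) (wgt i) (x i)) ->
  (forall m, m \in msupp H -> \sum_i m i * wgt i <= D)%N ->
  (\sum_(m <- msupp H) H@_m *: \prod_i P i ^+ m i)`_D =
  (\sum_(m <- msupp H | (\sum_i m i * wgt i == D)%N) H@_m *: 'X_[m] : {mpoly C[N]}).@[x].
Proof.
move=> Px HD; rewrite coef_sum raddf_sum /= [RHS]big_mkcond /= big_seq [RHS]big_seq.
apply: eq_bigr => m mH; rewrite coefZ.
have [sz co] := topcoef_prod (fun i => topcoefX (m i) (Px i)).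
case: eqP => [<-|ne]; first by rewrite co mevalZ mevalX.
rewrite nth_default ?mulr0 // (leq_trans sz) // ltn_neqAle HD // andbT.
exact/eqP.
Qed.

End WeightedTop.

Section IndependentBlocks.
Variables (C : closedFieldType) (N k : nat) (L : finType).
Variables (a : 'I_N -> 'X_{1..k}) (S : L -> {set 'I_N}).
Hypothesis disjS : forall l l' j, j \in S l -> j \in S l' -> l = l'.

(** By the dichotomy it suffices to find, for every H != 0, a solvable system
    with coefficients outside the zero set of H. *)
Lemma independent_solvable : ~ dependent_blocks a S ->
  generically (fun c : 'I_N -> C => solvable a S c).
Proof.
move=> indep; pose L0 := [set l | S l != set0].
have [L00|[l0]] := set_0Vmem L0.
  exists 1; rewrite ?oner_neq0 // => c _; exists (fun=> 1) => [i|l]; first exact: oner_neq0.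
  have /setP/(_ l) := L00; rewrite !inE => /negbFE/eqP Sl.
  by rewrite /blocksum Sl big_set0.
rewrite inE => /set0Pn[j0 _].
pose m l := odflt j0 [pick j in S l].
have mS l : l \in L0 -> m l \in S l.
  by rewrite inE => /set0Pn[j jS]; rewrite /m; case: pickP => // /(_ j); rewrite jS.
(* Rado's theorem gives two monomials m l and m' l in each equation. *)
pose w l j := ratexp (a j) - ratexp (a (m l)).
have [|m' m'S dm] := @rado _ _ _ _ w j0 L0 S.
  move=> T TL; rewrite leqNgt; apply/negP => lt; apply: indep.
  exists T, (famspan w S T); split=> // [l /(subsetP TL)|l j j' lT jS jS'].
    by rewrite inE.
  have -> : ratexp (a j) - ratexp (a j') = w l j - w l j'.
    by rewrite /w opprB addrA subrK.
  by rewrite memvB // mem_famspan.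
pose v l := divm (a (m' l)) - divm (a (m l)).
have {}dm : (#|L0| <= \dim (\sum_(l in L0) <[map_mx intr (v l) : 'rV[rat]_k]>)%VS)%N.
  by under eq_bigr do rewrite raddfB.
have mm' l : l \in L0 -> m' l != m l.
  move=> lL; have [q q0 [B BE]] := dual_basis dm; have := BE l l lL lL.
  apply: contra_eqN => /eqP E; rewrite /v E subrr mul0mx eqxx mulr1n eq_sym.
  apply/eqP => /matrixP/(_ 0 0); rewrite !mxE eqxx mulr1n => /eqP.
  by rewrite eqz_nat (gtn_eqF q0).
have [//|unsolv] := solvable_dichotomy C a S.
case: unsolv => H H0 Hns.
(* The coefficients of the chosen monomials have weight 1, the others 0. *)
pose K := [set m l | l in L0]; pose K' := [set m' l | l in L0].
pose wgt i : nat := (i \in K) || (i \in K').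
pose D := (\max_(al <- msupp H) \sum_i al i * wgt i)%N.
have HD al : al \in msupp H -> (\sum_i al i * wgt i <= D)%N.
  by move=> alH; rewrite /D (big_rem al) //= leq_maxl.
pose Htop : {mpoly C[N]} :=
  \sum_(al <- msupp H | (\sum_i al i * wgt i == D)%N) H@_al *: 'X_[al].
have Htop0 : Htop != 0.
  have [al alH alD] : exists2 al, al \in msupp H & (\sum_i al i * wgt i = D)%N.
    have : msupp H != [::] by rewrite msupp_eq0.
    rewrite /D; elim: (msupp H) => // al s IH _; rewrite big_cons.
    have [->|/IH[be bes <-]] := eqVneq s [::].
      by exists al; rewrite ?mem_head // big_nil maxn0.
    set u := (\sum_i al i * _)%N; set u' := (\sum_i be i * _)%N.
    have [le|lt] := leqP u' u; first by exists al; rewrite ?mem_head // (maxn_idPl le).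
    by exists be; rewrite ?in_cons ?bes ?orbT // (maxn_idPr (ltnW lt)).
  apply: contraTneq (alH) => /mpolyP/(_ al); rewrite mcoeff0 /Htop raddf_sum /=.
  rewrite -big_filter (bigD1_seq al) ?filter_uniq ?msupp_uniq ?mem_filter ?alD ?eqxx //=.
  rewrite mcoeffZ mcoeffX eqxx mulr1 big1 ?addr0 => [/eqP|be /negPf ne].
    by rewrite mcoeff_eq0.
  by rewrite mcoeffZ mcoeffX ne mulr0.
have [x x0 Hx] := torus_nonvanishing Htop0.
have [|y y0 yE] := @binomial_system C k L L0 v (fun l => - x (m l) / x (m' l)) dm.
  by move=> l; rewrite mulf_neq0 ?invr_eq0 ?oppr_eq0.
(* The point y solves the binomial system with coefficients x; adding r to the
   coefficients of the monomials m l, it solves the whole system, also after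
   multiplication of the chosen coefficients by s. *)
pose rest l := \sum_(j in S l :\ m l :\ m' l) x j * tmon y (divm (a j)).
pose r i := - \sum_(l in L0 | m l == i) rest l / tmon y (divm (a i)).
have tn0 u : tmon y u != 0 by exact: tmon_neq0.
have disjm l l' : l \in L0 -> l' \in L0 -> m l' \in S l -> l = l'.
  by move=> lL lL' mlS; apply: disjS mlS (mS l' lL').
have rm l : l \in L0 -> r (m l) * tmon y (divm (a (m l))) = - rest l.
  move=> lL; rewrite /r mulNr (big_pred1 l) ?divfK // => l'.
  apply/andP/eqP => [[lL' /eqP E]|->//]; apply/esym.
  by apply: disjm => //; rewrite E mS.
have rK i : i \notin K -> r i = 0.
  move=> iK; rewrite /r big_pred0 ?oppr0 // => l; apply/andP => -[lL /eqP E].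
  by move: iK; rewrite -E imset_f.
pose P i : {poly C} := x i *: 'X^(wgt i) + (r i)%:P.
have Ptop i : topcoef (P i) (wgt i) (x i).
  rewrite /topcoef /P /wgt; case: (boolP (i \in K)) => iK /=.
    split; last by rewrite coefD coefZ coefX coefC mulr1 addr0.
    rewrite (leq_trans (size_polyD _ _)) // geq_max.
    rewrite (leq_trans (size_scale_leq _ _)) ?size_polyX //.
    by rewrite (leq_trans (size_polyC_leq1 _)).
  rewrite rK // addr0; split.
    by rewrite (leq_trans (size_scale_leq _ _)) // size_polyXn.
  by rewrite coefZ coefXn eqxx mulr1.
pose G : {poly C} := \sum_(al <- msupp H) H@_al *: \prod_i P i ^+ al i.
have G0 : G != 0.
  apply: contraNneq Hx => G0; rewrite -(topcoef_comp Ptop HD) -/G G0 coef0 //.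
have [s _ Gs] := poly_nonroot G0.
case: (Hns (fun i => (P i).[s])).
  rewrite mevalE; move: Gs; rewrite /G horner_sum; congr (_ != 0).
  apply: eq_bigr => al _; rewrite hornerZ horner_prod; congr (_ * _).
  by apply: eq_bigr => i _; rewrite horner_exp.
exists y => // l; rewrite /blocksum.
have [lL|] := boolP (l \in L0); last by rewrite inE negbK => /eqP->; rewrite big_set0.
rewrite (big_setD1 (m l)) ?mS //= (big_setD1 (m' l)) /=; last by rewrite !inE mm' ?m'S.
have PE i : (P i).[s] = x i * s ^+ wgt i + r i by rewrite /P !hornerE.
have mK : m l \in K by rewrite imset_f.
have m'K : m' l \in K' by rewrite imset_f.
have m'nK : m' l \notin K.
  apply/imsetP => -[l' lL' E]; have := mm' l lL; rewrite E; case/eqP.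
  by congr m; apply/esym/disjm => //; rewrite -E m'S.
rewrite (_ : \sum_(j in _) _ = rest l); last first.
  apply: eq_bigr => j; rewrite !inE => /and3P[jm' jm jS]; rewrite PE.
  have jK : j \notin K.
    apply: contra jm => /imsetP[l' lL' jE]; rewrite jE in jS *.
    by rewrite (disjm _ _ lL lL' jS).
  have jK' : j \notin K'.
    apply: contra jm' => /imsetP[l' lL' jE]; rewrite jE in jS *.
    by rewrite (disjS jS (m'S _ lL')).
  by rewrite /wgt (negPf jK) (negPf jK') rK // addr0 mulr1.
rewrite !PE /wgt mK m'K orbT (rK _ m'nK) addr0 /= !expr1 !mulrDl rm //.
have := yE l lL; rewrite /v tmonD // => yv.
have {}yv : x (m' l) * tmon y (divm (a (m' l))) = - x (m l) * tmon y (divm (a (m l))).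
  have -> : tmon y (divm (a (m' l))) = - x (m l) / x (m' l) * tmon y (divm (a (m l))).
    by rewrite -yv -mulrA -tmonD // addNr tmon0 mulr1.
  by rewrite mulrA [x (m' l) * _]mulrC divfK.
rewrite [x (m' l) * s]mulrC -[s * x (m' l) * _]mulrA yv; ring.
Qed.

End IndependentBlocks.

(** At a singular zero the vectors (1, a_j), weighted by the terms c_j y^(a_j),
    have sum zero.  In a basis of their span U, chosen among them, this gives
    \dim U relations; each expresses one coefficient by the others and by
    monomials with exponents a_b - a_j.  These differences lie in the
    intersection of U with a hyperplane not containing U. *)
Lemma generically_smooth_torus (C : numClosedFieldType) N k
    (a : 'I_N -> 'X_{1..k}) (B : {set 'I_N}) : B != set0 ->
  generically (fun c : 'I_N -> C => ~ exists2 y, torus y &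
    blocksum a c y B = 0 /\
    forall i, \sum_(j in B) (a j i)%:R * (c j * tmon y (divm (a j))) = 0).
Proof.
case/set0Pn=> j0 j0B; pose w j : 'rV[int]_(1 + k) := row_mx 1 (divm (a j)).
pose wq j : 'rV[rat]_(1 + k) := map_mx intr (w j).
pose U := (\sum_(j in B) <[wq j]>)%VS.
have wU j : j \in B -> wq j \in U by move=> jB; rewrite memvE (sumv_sup j).
have [|f fB df] := @rado _ _ 'I_(\dim U) _ (fun _ => wq) j0 setT (fun _ => B).
  move=> T _; have [->|/set0Pn[t tT]] := eqVneq T set0; first by rewrite cards0.
  rewrite (leq_trans (max_card _)) // card_ord dimvS //.
  apply/subv_sumP => j jB; rewrite -memvE.
  exact: (@mem_famspan _ _ _ _ (fun _ => wq) _ _ t).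
have [q q0 [D DE]] := @dual_basis _ _ setT (fun l => w (f l)) df.
(* E l j is q times the l-th coordinate of (1, a_j) in the basis. *)
pose E l j : int := (w j *m D l) 0 0.
have Ef l l' : E l (f l') = q%:Z *+ (l' == l).
  by rewrite /E DE ?inE // mxE eqxx mulr1n.
have f_inj : injective f.
  move=> l l' ff; apply: contra_eq (Ef l l') => ne.
  by rewrite -ff Ef eqxx (eq_sym l') (negPf ne) mulr1n mulr0n eqz_nat (gtn_eqF q0).
have qC : q%:R != 0 :> C by rewrite pnatr_eq0 (gtn_eqF q0).
pose K := f @: setT.
have cK : #|K| = \dim U by rewrite card_imset // cardsT card_ord.
pose lam j b : C := if b \in B then - \sum_(l | f l == j) (E l b)%:~R / q%:R else 0.
pose e j b : 'rV[int]_k := if b \in B then divm (a b) - divm (a j) else 0.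
pose h : 'Hom('rV[rat]_(1 + k), 'rV[rat]_1) := linfun lsubmx.
pose p : 'Hom('rV[rat]_(1 + k), 'rV[rat]_k) := linfun rsubmx.
have hw j : h (wq j) = 1 by rewrite lfunE /= /wq map_row_mx row_mxKl map_mx1.
have pw j : p (wq j) = map_mx intr (divm (a j)) by rewrite lfunE /= /wq map_row_mx row_mxKr.
pose U0 := (U :&: lker h)%VS.
have U0lt : (\dim U0 < \dim U)%N.
  rewrite ltn_neqAle dimvS ?capvSl // andbT; apply: contraTneq (wU j0 j0B) => dE.
  have: (U0 == U)%VS by rewrite eqEdim capvSl dE /=.
  move/eqP=> <-; rewrite memv_cap memv_ker hw negb_and oner_neq0 orbT //.
have [||H H0 HP] := @torus_elimination C N k K lam e (p @: U0)%VS.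
- move=> j b /imsetP[l _ ->] _; rewrite /e; case: ifP => bB; last by rewrite raddf0 mem0v.
  rewrite raddfB /= -!pw -raddfB memv_img //.
  rewrite memv_cap memv_ker raddfB /= !hw subrr eqxx andbT.
  by rewrite memvB ?wU ?fB.
- by rewrite cK (leq_ltn_trans _ U0lt) // -(limg_ker_dim p U0) leq_addl.
exists H => // c /HP nc [y y0 [y1 y2]]; apply: nc; exists y => // _ /imsetP[l _ ->].
have t0 := tmon_neq0 (divm (a (f l))) y0.
have EE j : E l j = D l (lshift k 0) 0 + \sum_i (a j i)%:Z * D l (rshift 1 i) 0.
  rewrite /E mxE big_split_ord /= big_ord1 row_mxEl mxE eqxx mul1r; congr (_ + _).
  by apply: eq_bigr => i _; rewrite row_mxEr mxE.
have rel : \sum_(j in B) (E l j)%:~R * (c j * tmon y (divm (a j))) = 0.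
  transitivity ((D l (lshift k 0) 0)%:~R * blocksum a c y B +
     \sum_i (D l (rshift 1 i) 0)%:~R *
       \sum_(j in B) (a j i)%:R * (c j * tmon y (divm (a j)))).
    under [X in _ = _ + X]eq_bigr do rewrite mulr_sumr.
    rewrite exchange_big mulr_sumr -big_split; apply: eq_bigr => j jB /=.
    rewrite EE rmorphD mulrDl; congr (_ + _); rewrite rmorph_sum mulr_suml.
    by apply: eq_bigr => i _; rewrite /= intrM -pmulrn [LHS]mulrAC mulrC.
  by rewrite y1 mulr0 add0r big1 // => i _; rewrite y2 mulr0.
apply: (mulIf t0); apply: (mulfI qC); apply/eqP; rewrite -subr_eq0; apply/eqP.
rewrite -[RHS]rel [RHS](bigD1 (f l)) ?fB ?inE //= Ef eqxx mulr1n -pmulrn; congr (_ + _).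
rewrite [RHS](bigID (mem K)) /= [X in _ = X + _]big1 ?add0r; last first.
  move=> j /andP[/andP[_ ne] /imsetP[l' _ jE]]; rewrite jE in ne *.
  by rewrite Ef -(inj_eq f_inj) (negPf ne) mul0r.
rewrite [RHS](eq_bigl (fun j => (j \notin K) && (j \in B))); last first.
  move=> j; case: (boolP (j \in K)) => jK; rewrite ?andbF //= ?andbT.
  by rewrite (_ : j != f l) ?andbT //; apply: contraNneq jK => ->; rewrite imset_f.
rewrite big_mkcondr mulr_suml mulr_sumr -sumrN; apply: eq_bigr => b bK.
rewrite /lam /e; case: ifP => bB; last by rewrite !mul0r mulr0 oppr0.
rewrite (big_pred1 l) => [|l']; last by rewrite (inj_eq f_inj).
rewrite -[_ * _ * tmon y (divm (a (f l)))]mulrA -tmonD // subrK.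
by field.
Qed.

(** * Singular points of a general hypersurface *)

Section Coordinates.
Variables (C : fieldType) (k : nat).
Implicit Types (y : 'I_k -> C) (I : {set 'I_k}).

Definition freeof I (m : 'X_{1..k}) := [forall i in I, m i == 0%N].

Definition annul I y : 'I_k -> C := fun i => if i \in I then 0 else y i.

Lemma meval_annul I y m :
  ('X_[m] : {mpoly C[k]}).@[annul I y] = if freeof I m then tmon y (divm m) else 0.
Proof.
rewrite mevalX; case: ifP => [/'forall_implyP mI|/negbT].
  apply: eq_bigr => i _; rewrite mxE /annul; case: ifP => // /mI/eqP->.
  by rewrite expr0.
move=> /forall_inPn[i iI mi].
by rewrite (bigD1 i) //= /annul iI expr0n (negPf mi) mul0r.
Qed.

Definition singular (F : {mpoly C[k]}) y : Prop :=
  F.@[y] = 0 /\ forall i, (F^`M(i)).@[y] = 0.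

End Coordinates.

Section MonomialSums.
Variables (C : fieldType) (N k : nat) (a : 'I_N -> 'X_{1..k}).
Implicit Types (c : 'I_N -> C) (I : {set 'I_k}).

Definition genpoly c : {mpoly C[k]} := \sum_j c j *: 'X_[a j].

Definition free_monomials I : {set 'I_N} := [set j | freeof I (a j)].

(** For l in I, these are the monomials whose derivative along y_l is not
    identically zero on the stratum of I; for other l the block is empty, so that
    it imposes no equation and one can index the equations by all variables. *)
Definition block I (l : 'I_k) : {set 'I_N} :=
  [set j | (l \in I) && [forall i in I, a j i == (i == l)%N]].

Hypothesis a_inj : injective a.

Lemma mcoeff_genpoly c j : (genpoly c)@_(a j) = c j.
Proof.
rewrite raddf_sum /= (bigD1 j) //= mcoeffZ mcoeffX eqxx mulr1 big1 ?addr0 //.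
by move=> i /negPf ne; rewrite mcoeffZ mcoeffX (inj_eq a_inj) ne mulr0.
Qed.

Lemma msupp_genpoly c : (forall j, c j != 0) ->
  forall m, reflect (exists j, m = a j) (m \in msupp (genpoly c)).
Proof.
move=> c0 m; apply: (iffP idP) => [|[j ->]]; last by rewrite mcoeff_msupp mcoeff_genpoly.
rewrite mcoeff_msupp => nz.
have [/existsP[j /eqP->]|/existsPn no] := boolP [exists j, m == a j].
  by exists j.
case/eqP: nz; rewrite raddf_sum /= big1 // => j _.
by rewrite mcoeffZ mcoeffX eq_sym (negPf (no j)) mulr0.
Qed.

End MonomialSums.

Section Hypersurface.
Variables (C : numClosedFieldType) (N k : nat) (a : 'I_N -> 'X_{1..k}).
Implicit Types (c : 'I_N -> C) (y : 'I_k -> C) (I : {set 'I_k}).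
Notation genpoly := (genpoly a).
Notation free_monomials := (free_monomials a).
Notation block := (block a).

Lemma meval_genpoly c I y : (genpoly c).@[annul I y] = blocksum a c y (free_monomials I).
Proof.
rewrite raddf_sum /= /blocksum [RHS]big_mkcond; apply: eq_bigr => j _.
by rewrite mevalZ meval_annul inE; case: ifP => // _; rewrite mulr0.
Qed.

(** For l in I, the monomials that contribute to the derivative on the stratum are
    those of degree one in y_l and free of the rest of I.  The factor y l restores
    the monomials y^(a_j). *)
Lemma mderiv_genpoly c I y l : torus y ->
  y l * ((genpoly c)^`M(l)).@[annul I y] =
    if l \in I then blocksum a c y (block I l)
    else \sum_(j in free_monomials I) (a j l)%:R * (c j * tmon y (divm (a j))).
Proof.
move=> y0.
have split_mon (m : 'X_{1..k}) : m l != 0%N ->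
    y l * tmon y (divm (m - U_(l))) = tmon y (divm m).
  move=> ml; have le : (U_(l) <= m)%MM by rewrite lep1mP.
  rewrite -!meval_tmon -{2}(submK le) mpolyXD mevalM mevalXU mulrC //.
have -> : y l * ((genpoly c)^`M(l)).@[annul I y] =
    \sum_j if (a j l != 0%N) && freeof I (a j - U_(l)) then
       (a j l)%:R * (c j * tmon y (divm (a j))) else 0.
  have -> : (genpoly c)^`M(l) = \sum_j (c j *: 'X_[a j])^`M(l) by exact: linear_sum.
  rewrite raddf_sum mulr_sumr; apply: eq_bigr => j _ /=.
  rewrite mderivZ mderivX !mevalZ meval_annul.
  case: eqP => [->|/eqP ml] /=; first by rewrite mul0r !mulr0.
  case: ifP => _; last by rewrite !mulr0.
  by rewrite -(split_mon _ ml); ring.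
case: ifP => lI; rewrite /blocksum [RHS]big_mkcond; apply: eq_bigr => j _; rewrite inE.
  rewrite lI /=; have [al|ml] /= := eqVneq (a j l) 0%N.
    by rewrite ifF //; apply/negP => /forall_inP/(_ l lI); rewrite al eqxx.
  have -> : freeof I (a j - U_(l)) = [forall i in I, a j i == (i == l)].
    apply: eq_forallb => i; case iI: (i \in I) => //=.
    rewrite mnmBE mnm1E (eq_sym l); case: (eqVneq i l) => [->|_]; last by rewrite subn0.
    by case: (a j l) ml => // -[|n] _; rewrite ?subn0.
  by case: ifP => // /forall_inP/(_ l lI)/eqP->; rewrite eqxx mul1r.
have [->|ml] /= := eqVneq (a j l) 0%N; first by rewrite mul0r; case: ifP.
congr (if _ then _ else _); apply: eq_forallb => i; case iI: (i \in I) => //=.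
rewrite mnmBE mnm1E; case: (eqVneq l i) => [E|_]; last by rewrite subn0.
by rewrite -E lI in iI.
Qed.

Lemma block_disj I l l' j : j \in block I l -> j \in block I l' -> l = l'.
Proof.
rewrite !inE => /andP[lI /forall_inP/(_ l lI) al] /andP[_ /forall_inP/(_ l lI)].
by move: al; rewrite eqxx => /eqP->; case: (eqVneq l l').
Qed.

Lemma singular_annul c I y : torus y -> free_monomials I = set0 ->
  singular (genpoly c) (annul I y) <-> forall l, blocksum a c y (block I l) = 0.
Proof.
move=> y0 I0; split=> [[_ sF] l|sF].
  have [lI|lI] := boolP (l \in I); last first.
    by rewrite /blocksum big1 // => j; rewrite inE (negPf lI).
  by have := mderiv_genpoly c I l y0; rewrite sF mulr0 lI.
split=> [|l]; first by rewrite meval_genpoly I0 /blocksum big_set0.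
apply: (mulfI (y0 l)); rewrite mderiv_genpoly // sF I0 big_set0 mulr0.
by case: ifP.
Qed.

(** A stratum outside the base locus is handled by [generically_smooth_torus], and
    one inside by the solvability of the system of the blocks. *)
Lemma hypersurface_criterion I :
  generically (fun c => (exists2 y, torus y & singular (genpoly c) (annul I y)) <->
    free_monomials I = set0 /\ ~ dependent_blocks a (block I)).
Proof.
have [I0|I0] := eqVneq (free_monomials I) set0; last first.
  apply: generically_imp (generically_smooth_torus C a I0) => c nc.
  split; last by case=> /eqP; rewrite (negPf I0).
  case=> y y0 [sF sD]; case: nc; exists y => //; split; first by rewrite -meval_genpoly.
  move=> i; have := mderiv_genpoly c I i y0; rewrite sD mulr0; case: ifP => // iI _.
  by apply: big1 => j; rewrite inE => /forall_inP/(_ i iI)/eqP->; rewrite mul0r.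
have solvE c : (exists2 y, torus y & singular (genpoly c) (annul I y)) <->
    solvable a (block I) c.
  by split=> -[y y0 sy]; exists y => //; apply/(singular_annul c y0 I0).
have [dep|indep] := boolp.EM (dependent_blocks a (block I)).
  apply: generically_imp (dependent_unsolvable C (@block_disj I) dep) => c nc.
  by split=> [/solvE//|[_ /(_ dep)]].
apply: generically_imp (independent_solvable C (@block_disj I) indep) => c sc.
by split=> [//|_]; apply/solvE.
Qed.

End Hypersurface.

(** * Dependency of Newton polytopes *)

Section NewtonDependence.
Variables (C : numClosedFieldType) (N k : nat) (a : 'I_N -> 'X_{1..k}).
Hypothesis a_inj : injective a.
Variables (c : 'I_N -> C) (I : {set 'I_k}).
Hypothesis c0 : forall j, c j != 0.

Lemma msupp_gpart l m : l \in I ->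
  reflect (exists2 j, j \in block a I l & a j = (m + U_(l))%MM)
          (m \in msupp (gpart I l (genpoly a c))).
Proof.
move=> lI; rewrite mcoeff_msupp mcoeff_gpart.
have E (n : 'X_{1..k}) : n = (m + U_(l))%MM ->
    [forall tau in I, m tau == 0%N] = [forall i in I, n i == (i == l)%N].
  move=> ->; apply: eq_forallb => i; case: (i \in I) => //=.
  by rewrite mnmDE mnm1E (eq_sym l) -[in RHS](add0n (i == l)) eqn_add2r.
apply: (iffP idP) => [|[j]].
  case: ifP => [mI|]; last by rewrite eqxx.
  rewrite -mcoeff_msupp => /(msupp_genpoly a_inj c0)[j jE]; exists j => //.
  by rewrite inE lI /= -(E _ (esym jE)).
by rewrite inE => /andP[_ jI] jE; rewrite (E _ jE) jI -jE mcoeff_genpoly.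
Qed.

Lemma newton_vertex (h : {mpoly C[k]}) m : m \in msupp h -> newton h (ratexp m).
Proof.
move=> mh; exists (fun m' => (m' == m)%:R); split.
- by move=> m'; case: eqP.
- by rewrite (bigD1_seq m) //= eqxx big1 ?addr0 // => m' /negPf->.
rewrite (bigD1_seq m) //= eqxx scale1r big1 ?addr0
  => [|m' /negPf->]; last by rewrite scale0r.
by apply/rowP => i; rewrite !mxE -pmulrn.
Qed.

Lemma newton_translate (h : {mpoly C[k]}) (V : {vspace 'rV[rat]_k}) v :
  (forall m, m \in msupp h -> ratexp m + v \in V) ->
  forall p, newton h p -> p + v \in V.
Proof.
move=> hV p [w [_ w1 ->]].
have -> : v = \sum_(m <- msupp h) w m *: v by rewrite -scaler_suml w1 scale1r.
rewrite -big_split big_seq rpred_sum //= => m mh; rewrite -scalerDr memvZ //.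
have -> : \row_i (m i)%:R = ratexp m by apply/rowP => i; rewrite !mxE -pmulrn.
exact: hV.
Qed.

(** A polytope fits in a translate of V when its vertices do, that is when the
    differences of exponents are in V.  The family P may be indexed by any set T0
    in bijection with a set of indices containing those of the non-empty
    blocks. *)
Lemma dependent_newton (K : finType) (T0 : {set K}) (iota : K -> 'I_k)
    (P : K -> 'rV[rat]_k -> Prop) :
  {in T0 &, injective iota} ->
  (forall x, x \in T0 -> iota x \in I) ->
  (forall x, x \in T0 -> P x = newton (gpart I (iota x) (genpoly a c))) ->
  (forall l, block a I l != set0 -> exists2 x, x \in T0 & iota x = l) ->
  dependent T0 P <-> dependent_blocks a (block a I).
Proof.
move=> inj TI PE onto; split=> [[T [/subsetP TT0 Tn0 Pn0 [V [dV PV]]]]|[T [V [Tn0 TV dV]]]].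
  exists (iota @: T), V; split.
  - move=> _ /imsetP[x xT ->]; have [p] := Pn0 x xT; have xT0 := TT0 _ xT.
    rewrite PE // => -[w [_ w1 _]]; apply/set0Pn.
    have : msupp (gpart I (iota x) (genpoly a c)) != [::].
      by apply: contra_eq_neq w1 => ->; rewrite big_nil eq_sym oner_neq0.
    case E: msupp => [//|m s] _.
    have: m \in msupp (gpart I (iota x) (genpoly a c)) by rewrite E mem_head.
    by case/(msupp_gpart _ (TI _ xT0)) => j jB _; exists j.
  - move=> _ j j' /imsetP[x xT ->] jB jB'; have xT0 := TT0 _ xT.
    have [v vV] := PV x xT; rewrite PE // in vV.
    have xI := TI _ xT0.
    have key i : i \in block a I (iota x) -> ratexp (a i) - ratexp U_(iota x) + v \in V.
      move=> iB; have iU : (a i - U_(iota x) + U_(iota x))%MM = a i.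
        rewrite submK // lep1mP; move: iB.
        rewrite inE => /andP[_ /forall_inP/(_ _ xI)/eqP->].
        by rewrite eqxx.
      have -> : ratexp (a i) - ratexp U_(iota x) = ratexp (a i - U_(iota x)).
        apply/eqP; rewrite subr_eq -{1}iU; apply/eqP/rowP => t.
        by rewrite !mxE mnmDE PoszD rmorphD.
      apply/vV/newton_vertex/(msupp_gpart _ xI); by exists i.
    have -> : ratexp (a j) - ratexp (a j') = (ratexp (a j) - ratexp U_(iota x) + v) -
       (ratexp (a j') - ratexp U_(iota x) + v).
      by rewrite opprD addrACA subrr addr0 opprB addrA subrK.
    by rewrite memvB ?key.
  rewrite card_in_imset; last by move=> x y /TT0 xT /TT0 yT; apply: inj.
  by rewrite dV ltn_predL.
(* Dependency asks for #|T| = \dim V + 1 exactly, so T is shrunk. *)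
pose T1 := [set x in T0 | iota x \in T].
have cT1 : #|T1| = #|T|.
  rewrite -(card_in_imset (f := iota) (D := mem T1)); last first.
    by move=> x y; rewrite !inE => /andP[xT _] /andP[yT _]; apply: inj.
  apply: eq_card => l; apply/imsetP/idP => [[x]|lT]; first by rewrite inE => /andP[_ ?] ->.
  by have [x xT0 xl] := onto _ (Tn0 _ lT); exists x => //; rewrite inE xT0 xl.
have /card_geqP[s [us ss sT1]] : (\dim V < #|T1|)%N by rewrite cT1.
have cs : #|[set x in s]| = (\dim V).+1.
  by rewrite -ss -(card_uniqP us); apply: eq_card => x; rewrite inE.
have sP x : x \in s -> (x \in T0) /\ (iota x \in T) by move/sT1; rewrite inE => /andP.
have mE x : x \in s -> forall m, m \in msupp (gpart I (iota x) (genpoly a c)) ->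
    exists2 j, j \in block a I (iota x) & ratexp m = ratexp (a j) - ratexp U_(iota x).
  move=> /sP[xT0 _] m /(msupp_gpart _ (TI _ xT0))[j jB jE]; exists j => //.
  apply/eqP; rewrite eq_sym subr_eq jE; apply/eqP/rowP => t.
  by rewrite !mxE mnmDE PoszD rmorphD.
exists [set x in s]; split; rewrite ?cs //.
- by apply/subsetP => x; rewrite inE => /sP[].
- move=> x; rewrite inE => /sP[xT0 xT]; have [j jB] := set0Pn _ (Tn0 _ xT).
  have xI := TI _ xT0; rewrite PE //; exists (ratexp (a j - U_(iota x))).
  apply/newton_vertex/(msupp_gpart _ xI); exists j => //.
  rewrite submK // lep1mP; move: jB; rewrite inE => /andP[_ /forall_inP/(_ _ xI)/eqP->].
  by rewrite eqxx.
exists V; split=> // x; rewrite inE => xs; have [xT0 xT] := sP _ xs.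
have [j0 j0B] := set0Pn _ (Tn0 _ xT); rewrite PE //.
exists (- (ratexp (a j0) - ratexp U_(iota x))); apply: newton_translate.
move=> m /(mE _ xs)[j jB ->].
by rewrite opprB addrA subrK (TV _ _ _ xT).
Qed.

End NewtonDependence.

(** * The polynomial F = t1 g1 + t2 g2 and its strata *)

Section Projectivization.
Variable r : nat.

Definition liftm (m : 'X_{1..r}) : 'X_{1..r + 2} :=
  [multinom if split i is inl i0 then m i0 else 0%N | i < r + 2].

Definition dropm (m : 'X_{1..r + 2}) : 'X_{1..r} := [multinom m (ix i) | i < r].

Lemma liftm_ix m i : liftm m (ix i) = m i.
Proof. by rewrite mnmE /ix (unsplitK (inl i)). Qed.

Lemma liftm_it1 m : liftm m it1 = 0%N.
Proof. by rewrite mnmE /it1 (unsplitK (inr ord0)). Qed.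

Lemma liftm_it2 m : liftm m it2 = 0%N.
Proof. by rewrite mnmE /it2 (unsplitK (inr ord_max)). Qed.

Lemma index_cases (i : 'I_(r + 2)) : [\/ exists i0, i = ix i0, i = it1 | i = it2].
Proof.
rewrite -(splitK i); case: (split i) => [j|j] /=; first by constructor 1; exists j.
case: j => -[|[|//]] lt; [constructor 2|constructor 3]; exact: val_inj.
Qed.

Lemma it12 : (it1 == it2 :> 'I_(r + 2)) = false.
Proof. by rewrite /it1 /it2 eq_rshift. Qed.

Lemma it1_ix i : (it1 == ix i :> 'I_(r + 2)) = false.
Proof. by rewrite /it1 /ix eq_rlshift. Qed.

Lemma it2_ix i : (it2 == ix i :> 'I_(r + 2)) = false.
Proof. by rewrite /it2 /ix eq_rlshift. Qed.

Lemma ix_it1 i : (ix i == it1 :> 'I_(r + 2)) = false.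
Proof. by rewrite eq_sym it1_ix. Qed.

Lemma ix_it2 i : (ix i == it2 :> 'I_(r + 2)) = false.
Proof. by rewrite eq_sym it2_ix. Qed.

Lemma ix_inj : injective (@ix r).
Proof. exact: lshift_inj. Qed.

Lemma liftm_eq m m' :
  (liftm m == m') = [&& m' it1 == 0%N, m' it2 == 0%N & m == dropm m'].
Proof.
apply/eqP/and3P => [<-|[/eqP e1 /eqP e2 /eqP->]].
  rewrite liftm_it1 liftm_it2; split=> //; apply/eqP/mnmP => i.
  by rewrite mnmE liftm_ix.
apply/mnmP => i; have [[i0 ->]|->|->] := index_cases i.
- by rewrite liftm_ix mnmE.
- by rewrite liftm_it1.
- by rewrite liftm_it2.
Qed.

Variable C : fieldType.

Lemma toEX m : toE 'X_[m] = 'X_[liftm m] :> {mpoly C[r + 2]}.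
Proof.
rewrite /toE comp_mpolyX.
under eq_bigr => i _ do rewrite tnth_mktuple mpolyXn.
rewrite mprodXE; congr 'X_[_]; apply/mnmP => i.
rewrite mnm_sumE; have [[i0 ->]|->|->] := index_cases i.
- rewrite (bigD1 i0) //= mulmnE mnm1E eqxx mul1n big1 ?addn0 ?liftm_ix //.
  by move=> j /negPf ne; rewrite mulmnE mnm1E (inj_eq ix_inj) ne.
- by rewrite liftm_it1 big1 // => j _; rewrite mulmnE mnm1E ix_it1.
- by rewrite liftm_it2 big1 // => j _; rewrite mulmnE mnm1E ix_it2.
Qed.

Lemma toE_sum (T : finType) (f : T -> C) (m : T -> 'X_{1..r}) :
  toE (\sum_t f t *: 'X_[m t]) = \sum_t f t *: 'X_[liftm (m t)].
Proof.
rewrite /toE raddf_sum /=; apply: eq_bigr => t _.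
by rewrite comp_mpolyZ -toEX.
Qed.

Lemma mcoeff_toE (g : {mpoly C[r]}) m :
  (toE g)@_m = if (m it1 == 0%N) && (m it2 == 0%N) then g@_(dropm m) else 0.
Proof.
have gE : toE g = \sum_(m' <- msupp g) g@_m' *: 'X_[liftm m'].
  rewrite {1}[g]mpolyE /toE raddf_sum /=; apply: eq_bigr => m' _.
  by rewrite comp_mpolyZ -toEX.
rewrite gE raddf_sum /=.
under eq_bigr do rewrite mcoeffZ mcoeffX liftm_eq andbA.
case: ifP => _ /=; last by rewrite big1 // => m' _; rewrite mulr0.
have [dm|dm] := boolP (dropm m \in msupp g).
  rewrite (bigD1_seq (dropm m)) //= eqxx mulr1 big1 ?addr0 // => m' /negPf->.
  by rewrite mulr0.
rewrite big_seq big1 ?memN_msupp_eq0 // => m' m'g.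
by case: eqP m'g => [->|]; rewrite ?(negPf dm) ?mulr0.
Qed.

Lemma mcoeff_mulXU n (p : {mpoly C[n]}) i m :
  (p * 'X_i)@_m = if m i == 0%N then 0 else p@_(m - U_(i)).
Proof.
have [m0|m0] := eqVneq (m i) 0%N.
  apply: memN_msupp_eq0; apply/negP => /msuppM_le /allpairsP[[m1 m2]].
  rewrite msuppX inE /= => -[_ /eqP-> mE].
  by move: m0; rewrite mE mnmDE mnm1E eqxx addn1.
have le : (U_(i) <= m)%MM by rewrite lep1mP.
by rewrite -[in LHS](submK le) [X in (_ * _)@_X]addmC; exact: mcoeffMX.
Qed.

Lemma mcoeff_toE_it1 (g : {mpoly C[r]}) m :
  (toE g * 'X_it1)@_m =
    if (m it1 == 1%N) && (m it2 == 0%N) then g@_(dropm m) else 0.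
Proof.
rewrite mcoeff_mulXU mcoeff_toE !mnmBE !mnm1E eqxx it12 subn0.
have -> : dropm (m - U_(it1)) = dropm m.
  by apply/mnmP => i; rewrite !mnmE it1_ix subn0.
by case: (m it1) => [|[|n]].
Qed.

Lemma mcoeff_toE_it2 (g : {mpoly C[r]}) m :
  (toE g * 'X_it2)@_m =
    if (m it1 == 0%N) && (m it2 == 1%N) then g@_(dropm m) else 0.
Proof.
rewrite mcoeff_mulXU mcoeff_toE !mnmBE !mnm1E eqxx (eq_sym it2) it12 subn0.
have -> : dropm (m - U_(it2)) = dropm m.
  by apply/mnmP => i; rewrite !mnmE it2_ix subn0.
by case: (m it2) => [|[|n]]; rewrite ?andbT ?andbF.
Qed.

Implicit Types (g : {mpoly C[r]}) (I : {set 'I_(r + 2)}).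

Lemma mcoeff_polyF g1 g2 m : (polyF g1 g2)@_m =
  (if (m it1 == 1%N) && (m it2 == 0%N) then g1@_(dropm m) else 0) +
  (if (m it1 == 0%N) && (m it2 == 1%N) then g2@_(dropm m) else 0).
Proof.
by rewrite /polyF !(mulrC 'X__) mcoeffD mcoeff_toE_it1 mcoeff_toE_it2.
Qed.

Lemma dropmDix m i : dropm (m + U_(ix i)) = (dropm m + U_(i))%MM.
Proof. by apply/mnmP => j; rewrite mnmE !mnmDE [dropm _ _]mnmE !mnm1E (inj_eq ix_inj).  Qed.

Lemma freeof_dropm I m : freeof I m -> freeof (Jset I) (dropm m).
Proof.
move/forall_inP=> mI; apply/forall_inP => i; rewrite inE mnmE => iI.
exact: mI.
Qed.

(** The polynomial of case (iii) is the derivative of F along x_rho, restricted to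
    the stratum; if t1 or t2 is in I, it reduces to that of case (ii) or (i). *)
Lemma restr_gpart_ix g1 g2 I rho :
  restr I (toE (gpart (Jset I) rho g1) * 'X_it1 +
           toE (gpart (Jset I) rho g2) * 'X_it2) =
  gpart I (ix rho) (polyF g1 g2).
Proof.
apply/mpolyP => m; rewrite mcoeff_restr mcoeff_gpart.
case: ifP => // mI; rewrite mcoeffD mcoeff_toE_it1 mcoeff_toE_it2 mcoeff_polyF.
rewrite !mcoeff_gpart -/(freeof (Jset I) (dropm m)) freeof_dropm //.
by rewrite dropmDix !mnmDE !mnm1E ix_it1 ix_it2 !addn0.
Qed.

Lemma restr_toE_it1 g I : it1 \in I -> restr I (toE g * 'X_it1) = 0.
Proof.
move=> iI; apply/mpolyP => m; rewrite mcoeff_restr mcoeff0.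
by case: ifP => // /forall_inP/(_ _ iI)/eqP m0; rewrite mcoeff_toE_it1 m0.
Qed.

Lemma restr_toE_it2 g I : it2 \in I -> restr I (toE g * 'X_it2) = 0.
Proof.
move=> iI; apply/mpolyP => m; rewrite mcoeff_restr mcoeff0.
by case: ifP => // /forall_inP/(_ _ iI)/eqP m0; rewrite mcoeff_toE_it2 m0 andbF.
Qed.

Lemma restrD k (I : {set 'I_k}) (p q : {mpoly C[k]}) :
  restr I (p + q) = restr I p + restr I q.
Proof.
apply/mpolyP => m; rewrite mcoeffD !mcoeff_restr mcoeffD.
by case: ifP => _; rewrite ?addr0.
Qed.

(** The polynomials g1' and g2' of cases (ii) and (i) are the restricted
    derivatives of F along t1 and t2. *)
Lemma gpart_it1 g1 g2 I : it1 \in I ->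
  restr I (toE (gprime (Jset I) g1)) = gpart I it1 (polyF g1 g2).
Proof.
move=> iI; apply/mpolyP => m; rewrite mcoeff_restr mcoeff_gpart.
case: ifP => // mI; rewrite mcoeff_toE mcoeff_polyF mcoeff_restr.
rewrite -/(freeof (Jset I) (dropm m)) freeof_dropm // !mnmDE !mnm1E eqxx it12.
have -> : dropm (m + U_(it1)) = dropm m.
  by apply/mnmP => i; rewrite !mnmE it1_ix addn0.
by rewrite addn0 !addn1 eqSS /= addr0.
Qed.

Lemma gpart_it2 g1 g2 I : it2 \in I ->
  restr I (toE (gprime (Jset I) g2)) = gpart I it2 (polyF g1 g2).
Proof.
move=> iI; apply/mpolyP => m; rewrite mcoeff_restr mcoeff_gpart.
case: ifP => // mI; rewrite mcoeff_toE mcoeff_polyF mcoeff_restr.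
rewrite -/(freeof (Jset I) (dropm m)) freeof_dropm // !mnmDE !mnm1E eqxx (eq_sym it2) it12.
have -> : dropm (m + U_(it2)) = dropm m.
  by apply/mnmP => i; rewrite !mnmE it2_ix addn0.
by rewrite addn0 !addn1 andbF add0r eqSS.
Qed.

Lemma msupp_polyF g1 g2 m : m \in msupp (polyF g1 g2) =
  [|| [&& m it1 == 1%N, m it2 == 0%N & dropm m \in msupp g1] |
      [&& m it1 == 0%N, m it2 == 1%N & dropm m \in msupp g2]].
Proof.
rewrite mcoeff_msupp mcoeff_polyF !mcoeff_msupp.
case: (m it1) => [|[|n]]; case: (m it2) => [|[|n']] /=;
  by rewrite ?orbF ?addr0 ?add0r ?eqxx.
Qed.

Lemma freeof_add_t1 I m :
  freeof I (liftm m + U_(it1))%MM = (it1 \notin I) && freeof (Jset I) m.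
Proof.
apply/forall_inP/andP => [mI|[iI /forall_inP mJ] i].
  split; first by apply/negP => /mI; rewrite mnmDE mnm1E eqxx addn1.
  apply/forall_inP => i; rewrite inE => /mI.
  by rewrite mnmDE mnm1E it1_ix addn0 liftm_ix.
have [[i0 ->]|->|->] := index_cases i; last 2 first.
- by rewrite (negPf iI).
- by rewrite mnmDE mnm1E it12 liftm_it2.
by move=> iJ; rewrite mnmDE mnm1E it1_ix addn0 liftm_ix mJ // inE.
Qed.

Lemma freeof_add_t2 I m :
  freeof I (liftm m + U_(it2))%MM = (it2 \notin I) && freeof (Jset I) m.
Proof.
apply/forall_inP/andP => [mI|[iI /forall_inP mJ] i].
  split; first by apply/negP => /mI; rewrite mnmDE mnm1E eqxx addn1.
  apply/forall_inP => i; rewrite inE => /mI.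
  by rewrite mnmDE mnm1E it2_ix addn0 liftm_ix.
have [[i0 ->]|->|->] := index_cases i; last 2 first.
- by rewrite mnmDE mnm1E (eq_sym it2) it12 liftm_it1.
- by rewrite (negPf iI).
by move=> iJ; rewrite mnmDE mnm1E it2_ix addn0 liftm_ix mJ // inE.
Qed.

End Projectivization.

Section Strata.
Variables (C : fieldType) (r : nat) (Z : projective_toric r).
Implicit Types (I : {set 'I_(r + 2)}) (y : 'I_(r + 2) -> C).

(** Belonging to the domain depends only on which coordinates vanish, and becomes
    weaker when fewer of them do. *)
Lemma stratum_annul I y : toric_stratum C Z I -> torus y -> hatD Z I (annul I y).
Proof.
move=> [x [[[s sF xs] xt] xI]] y0; split; last by move=> i iI; rewrite /annul iI.
have nI i : x i != 0 -> annul I y i != 0.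
  by rewrite /annul; case: ifP => // /xI->; rewrite eqxx.
have xn i : annul I y i = 0 -> x i = 0.
  by move=> yi; apply/eqP; apply: contra_eqT yi => /nI.
split; first exists s => //.
  by move/prodf_neq0: xs => xs; apply/prodf_neq0 => i /xs; apply: nI.
by case=> /xn t1 /xn t2; apply: xt.
Qed.

Lemma stratum_it12 I : toric_stratum C Z I -> it1 \in I -> it2 \in I -> False.
Proof. by move=> [x [[_ xt] xI]] /xI x1 /xI x2; apply: xt. Qed.

Lemma torus1 k : @torus C k (fun=> 1).
Proof. by move=> i; exact: oner_neq0. Qed.

Lemma meval_eq0 k (J : {set 'I_k}) (m : 'X_{1..k}) (y : 'I_k -> C) :
  (forall i, i \in J -> y i = 0) -> ~~ freeof J m -> ('X_[m] : {mpoly C[k]}).@[y] = 0.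
Proof.
move=> yJ /forall_inPn[i iJ mi].
by rewrite mevalX (bigD1 i) //= yJ // expr0n (negPf mi) mul0r.
Qed.

Lemma hatD_baseB I (h : {mpoly C[r + 2]}) : toric_stratum C Z I ->
  (forall y, hatD Z I y -> baseB Z h y) <-> ~~ has (freeof I) (msupp h).
Proof.
move=> sI; split=> [hB|/hasPn hI y [yZ yI]].
  apply/hasPn => m mh; have [_ /(_ m mh)] := hB _ (stratum_annul sI (@torus1 _)).
  rewrite meval_annul; case: ifP => // _ t0.
  by have := tmon_neq0 (divm m) (@torus1 (r + 2)); rewrite t0 eqxx.
by split=> // m /hI mI; apply: meval_eq0 yI mI.
Qed.

Lemma hatD_hatB I (g : {mpoly C[r]}) : toric_stratum C Z I ->
  (forall y, hatD Z I y -> hatB Z g y) <-> ~~ has (freeof (Jset I)) (msupp g).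
Proof.
move=> sI; split=> [hB|/hasPn hI y [yZ yI]].
  apply/hasPn => m mh; have [_ [_ /(_ m mh)]] := hB _ (stratum_annul sI (@torus1 _)).
  have -> : ('X_[m] : {mpoly C[r]}).@[hatpi (annul I (fun=> 1))] =
            ('X_[m] : {mpoly C[r]}).@[annul (Jset I) (fun=> 1)].
    by apply: mpoly.meval_eq => i; rewrite /hatpi /annul inE.
  rewrite meval_annul; case: ifP => // _ t0.
  by have := tmon_neq0 (divm m) (@torus1 r); rewrite t0 eqxx.
split=> //; split; first by case: yZ.
by move=> m /hI mI; apply: meval_eq0 mI => i; rewrite inE => /yI.
Qed.

Lemma has_freeof_polyF I (g1 g2 : {mpoly C[r]}) :
  has (freeof I) (msupp (polyF g1 g2)) =
    (it1 \notin I) && has (freeof (Jset I)) (msupp g1) ||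
    (it2 \notin I) && has (freeof (Jset I)) (msupp g2).
Proof.
have dl1 m : dropm (liftm m + U_(it1)) = m :> 'X_{1..r}.
  by apply/mnmP => i; rewrite [LHS]mnmE mnmDE mnm1E it1_ix addn0 liftm_ix.
have dl2 m : dropm (liftm m + U_(it2)) = m :> 'X_{1..r}.
  by apply/mnmP => i; rewrite [LHS]mnmE mnmDE mnm1E it2_ix addn0 liftm_ix.
have ld1 (m : 'X_{1..r + 2}) : m it1 = 1%N -> m it2 = 0%N ->
    m = (liftm (dropm m) + U_(it1))%MM.
  move=> m1 m2; apply/mnmP => i; rewrite mnmDE mnm1E.
  have [[j ->]|->|->] := index_cases i.
  - by rewrite liftm_ix [dropm _ _]mnmE it1_ix addn0.
  - by rewrite liftm_it1 eqxx m1.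
  - by rewrite liftm_it2 it12 m2.
have ld2 (m : 'X_{1..r + 2}) : m it1 = 0%N -> m it2 = 1%N ->
    m = (liftm (dropm m) + U_(it2))%MM.
  move=> m1 m2; apply/mnmP => i; rewrite mnmDE mnm1E.
  have [[j ->]|->|->] := index_cases i.
  - by rewrite liftm_ix [dropm _ _]mnmE it2_ix addn0.
  - by rewrite liftm_it1 (eq_sym it2) it12 m1.
  - by rewrite liftm_it2 eqxx m2.
apply/hasP/orP => [[m]|].
  rewrite msupp_polyF => /orP[]/and3P[/eqP m1 /eqP m2 mg].
    rewrite (ld1 _ m1 m2) freeof_add_t1 => /andP[-> mI]; left.
    by apply/hasP; exists (dropm m).
  rewrite (ld2 _ m1 m2) freeof_add_t2 => /andP[-> mI]; right.
  by apply/hasP; exists (dropm m).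
case=> /andP[iI /hasP[m mg mJ]].
  exists (liftm m + U_(it1))%MM; last by rewrite freeof_add_t1 iI.
  by rewrite msupp_polyF !mnmDE !mnm1E eqxx it12 liftm_it1 liftm_it2 dl1 mg.
exists (liftm m + U_(it2))%MM; last by rewrite freeof_add_t2 iI.
by rewrite msupp_polyF !mnmDE !mnm1E eqxx (eq_sym it2) it12 liftm_it1 liftm_it2 dl2 mg orbT.
Qed.

End Strata.

Section Criterion.
Variables (C : numClosedFieldType) (r : nat) (Z : projective_toric r).
Variables (A1 A2 : seq 'X_{1..r}).
Hypotheses (uniqA1 : uniq A1) (uniqA2 : uniq A2).

Definition Fexp (j : 'I_(size A1 + size A2)) : 'X_{1..r + 2} :=
  match split j with
  | inl i => (liftm (tnth (in_tuple A1) i) + U_(it1))%MM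
  | inr i => (liftm (tnth (in_tuple A2) i) + U_(it2))%MM
  end.

Lemma Fexp_inj : injective Fexp.
Proof.
have lift_inj i m m' : (liftm m + U_(i) = liftm m' + U_(i))%MM -> m = m' :> 'X_{1..r}.
  move=> /mnmP E; apply/mnmP => j; have := E (ix j).
  by rewrite !mnmDE !liftm_ix => /addIn.
have t_inj (A : seq 'X_{1..r}) : uniq A -> injective (tnth (in_tuple A)).
  by move=> uA; apply/tuple_uniqP.
have ne m m' : (liftm m + U_(it1) = liftm m' + U_(it2) :> 'X_{1..r + 2})%MM -> False.
  by move=> /mnmP/(_ it1); rewrite !mnmDE !mnm1E !liftm_it1 eqxx (eq_sym it2) it12.
move=> i j; rewrite /Fexp -{2}(splitK i) -{2}(splitK j).
case: (split i) => i'; case: (split j) => j'.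
- by move=> /lift_inj/(t_inj _ uniqA1)->.
- by move/ne.
- by move/esym/ne.
- by move=> /lift_inj/(t_inj _ uniqA2)->.
Qed.

Lemma polyF_lincomb (c : 'I_(size A1 + size A2) -> C) :
  polyF (lincomb (fun j => c (lshift (size A2) j)))
        (lincomb (fun j => c (rshift (size A1) j))) = genpoly Fexp c.
Proof.
rewrite /polyF /lincomb !toE_sum /genpoly big_split_ord /=; congr (_ + _);
  rewrite mulr_sumr; apply: eq_bigr => j _.
  by rewrite /Fexp (unsplitK (inl j)) -scalerAr -mpolyXD addmC.
by rewrite /Fexp (unsplitK (inr j)) -scalerAr -mpolyXD addmC.
Qed.

Section Fixed.
Variable c : 'I_(size A1 + size A2) -> C.
Hypothesis c0 : forall j, c j != 0.
Let g1 := lincomb (fun j => c (lshift (size A2) j)).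
Let g2 := lincomb (fun j => c (rshift (size A1) j)).
Variable I : {set 'I_(r + 2)}.
Hypothesis sI : toric_stratum C Z I.

Lemma free_monomialsE :
  (forall y, hatD Z I y -> baseB Z (polyF g1 g2) y) <-> free_monomials Fexp I = set0.
Proof.
rewrite (hatD_baseB _ sI) polyF_lincomb; split=> [/hasPn nf|I0].
  apply/setP => j; rewrite !inE; apply/negbTE/nf.
  by apply/(msupp_genpoly Fexp_inj c0); exists j.
apply/hasPn => m /(msupp_genpoly Fexp_inj c0)[j ->].
by have /setP/(_ j) := I0; rewrite !inE => ->.
Qed.

Lemma block_it1 : block Fexp I it1 != set0 -> has (freeof (Jset I)) (msupp g1).
Proof.
case/set0Pn=> j; rewrite inE => /andP[iI /forall_inP jI].
have : Fexp j \in msupp (polyF g1 g2).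
  by rewrite polyF_lincomb; apply/(msupp_genpoly Fexp_inj c0); exists j.
rewrite msupp_polyF (eqP (jI _ iI)) eqxx /= orbF => /andP[_ mg].
apply/hasP; exists (dropm (Fexp j)) => //.
by apply/forall_inP => i; rewrite inE mnmE => /jI; rewrite ix_it1.
Qed.

Lemma block_it2 : block Fexp I it2 != set0 -> has (freeof (Jset I)) (msupp g2).
Proof.
case/set0Pn=> j; rewrite inE => /andP[iI /forall_inP jI].
have : Fexp j \in msupp (polyF g1 g2).
  by rewrite polyF_lincomb; apply/(msupp_genpoly Fexp_inj c0); exists j.
rewrite msupp_polyF (eqP (jI _ iI)) eqxx /= andbF /= => /andP[_ mg].
apply/hasP; exists (dropm (Fexp j)) => //.
by apply/forall_inP => i; rewrite inE mnmE => /jI; rewrite ix_it2.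
Qed.

Lemma block_in l : block Fexp I l != set0 -> l \in I.
Proof. by case/set0Pn=> j; rewrite inE => /andP[]. Qed.

(** As t1 and t2 do not vanish together, a stratum in the base locus of F is in
    that of g1 or of g2.  If it is only in that of g1, then t2 is in I; if it is
    in both, then the blocks of t1 and t2 are empty. *)
Lemma conditionsE : free_monomials Fexp I = set0 ->
  [\/ cond_i Z g1 g2 I, cond_ii Z g1 g2 I | cond_iii Z g1 g2 I] <->
  dependent_blocks Fexp (block Fexp I).
Proof.
move/free_monomialsE/(hatD_baseB _ sI); rewrite has_freeof_polyF negb_or !negb_and !negbK.
have B1 := hatD_hatB g1 sI; have B2 := hatD_hatB g2 sI.
have J_in rho : rho \in Jset I -> ix rho \in I by rewrite inE.
have FE := polyF_lincomb c; rewrite -/g1 -/g2 in FE.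
have opt_inj t : (forall i, (t == ix i) = false) ->
    {in None |: [set Some rho | rho in Jset I] &,
      injective (fun x => if x is Some rho then ix rho else t)}.
  move=> tix [rho|] [rho'|] _ _ //.
  - by move=> /ix_inj->.
  - by move/eqP; rewrite eq_sym tix.
  - by move/eqP; rewrite tix.
have opt_in t : t \in I -> forall x, x \in None |: [set Some rho | rho in Jset I] ->
    (if x is Some rho then ix rho else t) \in I.
  move=> tI [rho|] //; rewrite !inE /= => /imsetP[rho' ? [->]]; exact: J_in.
have [f1|f1] := boolP (has _ (msupp g1)); have [f2|f2] := boolP (has _ (msupp g2));
  rewrite /= ?orbT ?orbF => /andP[t1 t2].
- by case: (stratum_it12 sI t1 t2).
- have t2I : it2 \notin I by apply/negP; apply: stratum_it12 sI t1.
  have depE : cond_ii Z g1 g2 I <-> dependent_blocks Fexp (block Fexp I).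
    rewrite /cond_ii -(dependent_newton Fexp_inj c0 (opt_inj _ (@it1_ix r)) (opt_in _ t1)
      (P := fun j => if j is Some rho then Delta I (toE (gpart (Jset I) rho g2) * 'X_it2)
              else Delta I (toE (gprime (Jset I) g1)))).
    + by split=> [[]//|h]; split=> //; split; [apply/B2|move/B1; rewrite f1].
    + move=> [rho|] _; rewrite /Delta -FE; last by rewrite (gpart_it1 g1 g2 t1).
      by rewrite -restr_gpart_ix restrD (restr_toE_it1 _ t1) add0r.
    move=> l lB; have [[i E]|E|E] := index_cases l.
    + by exists (Some i); rewrite // !inE /= imset_f // inE -E block_in.
    + by exists None; rewrite // !inE.
    + by move: (block_in lB); rewrite E (negPf t2I).
  rewrite -depE; split=> [[|//|]|]; last by constructor 2.
  + by case=> -[/B1]; rewrite f1.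
  + by case=> hB _; have := B1.1 (fun y yI => (hB y yI).1); rewrite f1.
- have t1I : it1 \notin I by apply/negP => t1I; apply: stratum_it12 sI t1I t2.
  have depE : cond_i Z g1 g2 I <-> dependent_blocks Fexp (block Fexp I).
    rewrite /cond_i -(dependent_newton Fexp_inj c0 (opt_inj _ (@it2_ix r)) (opt_in _ t2)
      (P := fun j => if j is Some rho then Delta I (toE (gpart (Jset I) rho g1) * 'X_it1)
              else Delta I (toE (gprime (Jset I) g2)))).
    + by split=> [[]//|h]; split=> //; split; [apply/B1|move/B2; rewrite f2].
    + move=> [rho|] _; rewrite /Delta -FE; last by rewrite (gpart_it2 g1 g2 t2).
      by rewrite -restr_gpart_ix restrD (restr_toE_it2 _ t2) addr0.
    move=> l lB; have [[i E]|E|E] := index_cases l.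
    + by exists (Some i); rewrite // !inE /= imset_f // inE -E block_in.
    + by move: (block_in lB); rewrite E (negPf t1I).
    + by exists None; rewrite // !inE.
  rewrite -depE; split=> [[//||]|]; last by constructor 1.
  + by case=> -[/B2]; rewrite f2.
  + by case=> hB _; have := B2.1 (fun y yI => (hB y yI).2); rewrite f2.
have depE : cond_iii Z g1 g2 I <-> dependent_blocks Fexp (block Fexp I).
  rewrite /cond_iii -(dependent_newton Fexp_inj c0 (T0 := Jset I) (iota := @ix r)
    (P := fun rho => Delta I (toE (gpart (Jset I) rho g1) * 'X_it1 +
                         toE (gpart (Jset I) rho g2) * 'X_it2))) //.
  - split=> [[]//|h]; split=> // y yI; split; [exact: (B1.2 f1)|exact: (B2.2 f2)].
  - by move=> i j _ _ /ix_inj.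
  - by move=> rho _; rewrite /Delta -FE restr_gpart_ix.
  move=> l lB; have [[i E]|E|E] := index_cases l.
  - by exists i; rewrite // inE -E block_in.
  - by move: (block_it1); rewrite -E lB (negPf f1) => /(_ isT).
  - by move: (block_it2); rewrite -E lB (negPf f2) => /(_ isT).
rewrite -depE; split=> [[||//]|]; last by constructor 3.
- by case=> -[_ []]; apply/B2.
- by case=> -[_ []]; apply/B1.
Qed.

End Fixed.

(** Replacing the zero coordinates by 1 lifts any point to the torus. *)
Lemma quasismooth_strata (F : {mpoly C[r + 2]}) :
  quasismooth Z F <-> forall I : {set 'I_(r + 2)}, toric_stratum C Z I ->
    ~ exists2 y, torus y & singular F (annul I y).
Proof.
split=> [qs I sI [y y0 [sF sD]]|qs [y [yZ sF sD]]].
  by apply: qs; exists (annul I y); split=> //; case: (stratum_annul sI y0).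
pose I := [set i | y i == 0].
have yE : y =1 annul I (fun i => if i \in I then 1 else y i).
  by move=> i; rewrite /annul; case: (boolP (i \in I)) => [|//]; rewrite inE => /eqP.
apply: (qs I); first by exists y; split=> // i; rewrite inE => /eqP.
exists (fun i => if i \in I then 1 else y i).
  by move=> i; case: (boolP (i \in I)) => [_|]; rewrite ?oner_neq0 // inE.
by split=> [|i]; rewrite -(mpoly.meval_eq _ yE).
Qed.

Theorem quasismooth_criterion : for_general A1 A2 (fun g1 g2 : {mpoly C[r]} =>
  quasismooth Z (polyF g1 g2) <->
  forall I : {set 'I_(r + 2)}, toric_stratum C Z I ->
    (forall y : 'I_(r + 2) -> C, hatD Z I y -> baseB Z (polyF g1 g2) y) ->
    [\/ cond_i Z g1 g2 I, cond_ii Z g1 g2 I | cond_iii Z g1 g2 I]).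
Proof.
have gen0 : generically (fun c : 'I_(size A1 + size A2) -> C => forall j, c j != 0).
  apply: (@generically_all _ _ _ (fun j c => c j != 0)) => j.
  exists 'X_j => [|c]; last by rewrite mevalXU.
  by rewrite -msize_poly_eq0 msizeX.
have crit := generically_all (hypersurface_criterion C Fexp).
apply: generically_imp (generically_and gen0 crit) => {crit}.
move=> c [c0 crit]; rewrite quasismooth_strata polyF_lincomb.
split=> qs I sI.
  rewrite -polyF_lincomb => /(free_monomialsE c0 sI) I0.
  apply/(conditionsE c0 sI I0); apply: boolp.contrapT => indep.
  by apply: (qs I sI); apply/crit.
move/crit=> [I0 indep]; apply/indep/(conditionsE c0 sI I0)/qs => //.
by rewrite -polyF_lincomb; apply/(free_monomialsE c0 sI).
Qed.

End Criterion.

Theorem proposition1p11 (R : realType) (r : nat) (Z : projective_toric r)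
    (d1 d2 : 'rV[int]_r) (A1 A2 : seq 'X_{1..r})
    (uniqA1 : uniq A1) (uniqA2 : uniq A2)
    (A1_neq0 : A1 != [::]) (A2_neq0 : A2 != [::])
    (degA1 : forall m, m \in A1 -> lin_equiv Z (divm m) d1)
    (degA2 : forall m, m \in A2 -> lin_equiv Z (divm m) d2) :
  @for_general R[i]%C r A1 A2 (fun g1 g2 =>
    quasismooth Z (polyF g1 g2) <->
    forall I : {set 'I_(r + 2)}, toric_stratum (R[i]%C : fieldType) Z I ->
      (forall y : 'I_(r + 2) -> R[i]%C, hatD Z I y -> baseB Z (polyF g1 g2) y) ->
      [\/ cond_i Z g1 g2 I, cond_ii Z g1 g2 I | cond_iii Z g1 g2 I]).
Proof. exact: (@quasismooth_criterion R[i]%C r Z A1 A2 uniqA1 uniqA2). Qed.
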